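(* The peak Young quasisymmetric Schur function basis $\{\widetilde{\mathcal{S}}_\alpha:\alpha\text{ a peak composition}\}$ of the peak algebra $\mathsf{Peak}$ contains the Schur $Q$-functions; that is, every Schur $Q$-function $Q_\lambda$ ($\lambda$ a strict partition) is a member of this basis.
   Context: Compositions. A composition $\alpha=(\alpha_1,\dots,\alpha_k)\vDash n$ is a sequence of positive integers with sum $n$; $\mathrm{Des}(\alpha)=\{\alpha_1,\alpha_1+\alpha_2,\dots,\alpha_1+\cdots+\alpha_{k-1}\}\subseteq [n-1]$, where $[m]=\{1,\dots,m\}$; $\mathrm{comp}_n(X)$ is the composition of $n$ with descent set $X\subseteq[n-1]$. For a set $X$ of positive integers, $\mathrm{Peak}(X)=\{i\in X: i>1,\ i-1\notin X\}$; $\mathrm{Peak}(\alpha)=\mathrm{Peak}(\mathrm{Des}(\alpha))$. A peak composition is a composition all of whose parts, except possibly the last, are greater than $1$. A strict partition of $n$ is a strictly decreasing sequence of positive integers with sum $n$. Functions. For $\alpha\vDash n$, $F_\alpha=\sum x_{i_1}\cdots x_{i_n}$ over positive integers $i_1\le\cdots\le i_n$ with $i_j<i_{j+1}$ whenever $j\in\mathrm{Des}(\alpha)$. For a peak composition $\alpha\vDash n$, $K_\alpha=2^{|\mathrm{Peak}(\alpha)|+1}\sum_\beta F_\beta$, sum over $\beta\vDash n$ with $\mathrm{Peak}(\alpha)\subseteq \mathrm{Des}(\beta)\triangle(\mathrm{Des}(\beta)+1)$ ($X+1=\{x+1:x\in X\}$). The peak algebra $\mathsf{Peak}$ has basis the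 functions $K_\alpha$. Algebras. $H_n(0)$ is the $\mathbb{C}$-algebra with generators $\pi_1,\dots,\pi_{n-1}$ and relations $\pi_i^2=-\pi_i$, $\pi_i\pi_j=\pi_j\pi_i$ for $|i-j|\ge2$, $\pi_i\pi_{i+1}\pi_i=\pi_{i+1}\pi_i\pi_{i+1}$. $HCl_n(0)$ is generated by $\pi_1,\dots,\pi_{n-1}$ (with these relations) and $c_1,\dots,c_n$ with $c_i^2=-1$, $c_ic_j=-c_jc_i$ for $i\ne j$, and $\pi_ic_j=c_j\pi_i$ for $j\ne i,i+1$, $\pi_ic_i=c_{i+1}\pi_i$, $(\pi_i+1)c_{i+1}=c_i(\pi_i+1)$. It is a superalgebra with $\pi_i$ of degree $0$, $c_j$ of degree $1$. Characteristic. For $\alpha\vDash n$, $\mathbf{F}_\alpha=\mathbb{C}v_\alpha$ is the simple $H_n(0)$-module with $\pi_iv_\alpha=-v_\alpha$ if $i\in\mathrm{Des}(\alpha)$ and $0$ otherwise, and $\mathbf{M}_\alpha$ is the $HCl_n(0)$-supermodule induced from $\mathbf{F}_\alpha$. The peak characteristic $\widetilde{ch}$ is the isomorphism of Bergeron, Hivert and Thibon from $\bigoplus_n\mathcal{G}_0(HCl_n(0))$ (Grothendieck groups of finite-dimensional supermodules) to $\mathsf{Peak}$, which satisfies $\widetilde{ch}([\mathbf{M}_\alpha])=K_{\mathrm{comp}_n(\mathrm{Peak}(\alpha))}$ for $\alpha\vDash n$. Diagram modules. Let $D$ be a diagram of $n$ boxes with a reading order (a total order on the boxes). A standard filling is a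 bijective assignment of $1,\dots,n$ to the boxes; $\mathrm{rw}(T)$ is the permutation given by the entries of $T$ in reading order from left to right; $s_iT$ exchanges the entries $i,i+1$ of $T$. For a nonempty set $\mathcal{T}$ of standard fillings and $T\in\mathcal{T}$, $\mathrm{Des}(T)$ is the set of $i\in[n-1]$ with $i$ to the right of $i+1$ in $\mathrm{rw}(T)$, and $\mathrm{Peak}(T)=\mathrm{Peak}(\mathrm{Des}(T))$. Elements of $[n-1]\setminus\mathrm{Des}(T)$ are ascents; an ascent $i$ is attacking if $s_iT\notin\mathcal{T}$ and nonattacking otherwise. $T$ has an ascent in positions $(r,s)$ if $r<s$ and $\mathrm{rw}(T)_s-\mathrm{rw}(T)_r=1$. $\mathcal{T}$ is ascent-compatible if whenever $T,T'\in\mathcal{T}$ both have an ascent in positions $(r,s)$, it is attacking in $T$ if and only if it is attacking in $T'$. In that case $\mathbf{N}_{\mathcal{T}}$ is the $H_n(0)$-module on the $\mathbb{C}$-span of $\mathcal{T}$ with $\pi_iT=-T$ if $i\in\mathrm{Des}(T)$, $0$ if $i$ is an attacking ascent, $s_iT$ if $i$ is a nonattacking ascent; and $\widetilde{\mathbf{N}}_{\mathcal{T}}=\mathrm{Ind}_{H_n(0)}^{HCl_n(0)}\mathbf{N}_{\mathcal{T}}$. Composition tableaux. $D(\alpha)$ is the left-justified array with $\alpha_i$ boxes in row $i$, rows numbered from bottom to top; $T(c,r)$ is the entry in column $c$, row $r$. $\mathsf{SYCT}(\alpha)$ is the set of standard fillings $T$ of $D(\alpha)$ such that: (SYCT1)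 entries increase from left to right along rows; (SYCT2) entries increase from bottom to top in the first column; (SYCT3) if boxes $(c,r)$ and $(c+1,r')$ with $r'<r$ are in $D(\alpha)$ and $T(c,r)<T(c+1,r')$, then $(c+1,r)$ is in $D(\alpha)$ and $T(c+1,r)<T(c+1,r')$. For a peak composition $\alpha\vDash n$, $\mathsf{SPYCT}(\alpha)$ is the set of $T\in\mathsf{SYCT}(\alpha)$ such that for every $1\le k\le n$ the boxes with entries at most $k$ form the diagram of a peak composition. The reading order reads the first column from top to bottom and each subsequent column from bottom to top, columns in order from left to right. $\mathsf{SPYCT}(\alpha)$ is ascent-compatible for this reading order. The peak Young quasisymmetric Schur function is $\widetilde{\mathcal{S}}_\alpha=\widetilde{ch}([\widetilde{\mathbf{N}}_{\mathsf{SPYCT}(\alpha)}])$; explicitly, $\widetilde{\mathcal{S}}_\alpha=\sum_{T\in\mathsf{SPYCT}(\alpha)}K_{\mathrm{comp}_n(\mathrm{Peak}(T))}$. Schur $Q$-functions. For a strict partition $\lambda\vdash n$, $\mathrm{ShD}(\lambda)$ has $\lambda_i$ boxes in row $i$ (rows numbered from bottom to top), in columns $i,\dots,i+\lambda_i-1$. $\mathsf{SShT}(\lambda)$ is the set of standard fillings of $\mathrm{ShD}(\lambda)$ with entries increasing from left to right along each row and from bottom to top in each column; the reading order reads rows from left to right, starting at the top row and proceeding downwards. The Schur $Q$-function is given by $Q_\lambda=\sum_{S\in\mathsf{SShT}(\lambda)}K_{\mathrm{comp}_n(\mathrm{Peak}(S))}$. *)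

(* Defs.v *)
From HB Require Import structures.
From mathcomp Require Import all_boot all_order all_algebra.
From mathcomp Require Import finmap multiset complex.
From mathcomp Require Import boolp classical_sets functions reals.

Set Implicit Arguments.
Unset Strict Implicit.
Unset Printing Implicit Defensive.

Import GRing.Theory.

Local Open Scope nat_scope.

(* Finite sets of positive integers are duplicate-free lists.  A composition  *)
(* is a list of positive integers, and n is recovered from it as [sumn].      *)

Definition is_comp (alpha : seq nat) : bool := all (leq 1) alpha.

Definition des (alpha : seq nat) : seq nat :=
  [seq sumn (take i alpha) | i <- iota 1 (size alpha).-1].

Definition comp_of (n : nat) (X : seq nat) : seq nat :=
  if n is 0 then [::]
  else pairmap (fun a b => b - a) 0 (rcons (sort leq X) n).

Definition peak (X : seq nat) : seq nat :=
  [seq i <- X | (1 < i) && (i.-1 \notin X)].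

Definition is_peak_comp (alpha : seq nat) : bool :=
  is_comp alpha && all (leq 2) (take (size alpha).-1 alpha).

Fixpoint compositions (n : nat) : seq (seq nat) :=
  match n with
  | 0 => [:: [::]]
  | 1 => [:: [:: 1]]
  | m.+1 => [seq 1 :: b | b <- compositions m]
            ++ [seq (head 0 b).+1 :: behead b | b <- compositions m]
  end.

Lemma mem_compositions n alpha :
  (alpha \in compositions n) = is_comp alpha && (sumn alpha == n).
Proof.
elim: n alpha => [|[|m] IH] alpha.
- rewrite inE; case: alpha => [|x t] //=.
  by case: x => [|x] //=; rewrite andbF.
- rewrite inE; case: alpha => [|x t] //=.
  case: x => [|[|x]] //=; case: t => [|y t] //=; rewrite ?andbF //.
  by case: y => [|y] //=; rewrite ?andbF.
have -> : compositions m.+2 = [seq 1 :: b | b <- compositions m.+1]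
   ++ [seq (head 0 b).+1 :: behead b | b <- compositions m.+1] by [].
rewrite mem_cat; apply/orP/andP.
  case=> /mapP [b]; rewrite IH => /andP [cb /eqP sb] ->; split.
  - by [].
  - by rewrite /= sb.
  - by case: b cb {sb} => [|x s] //= /andP [].
  - by case: b cb sb => [|x s] //= _; rewrite addSn => ->.
case: alpha => [|x s] /= [] //; case: x => [|[|x]] //= cs /eqP e.
- left; apply/mapP; exists s => //; rewrite IH.
  by move: e cs; rewrite add1n => -[->]; rewrite /is_comp /= eqxx andbT.
- right; apply/mapP; exists (x.+1 :: s) => //; rewrite IH /=.
  by move: e cs; rewrite !addSn => -[->]; rewrite /is_comp /= eqxx andbT.
Qed.

Lemma compositions_uniq n : uniq (compositions n).
Proof.
elim: n => [|[|m] IH] //.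
have -> : compositions m.+2 = [seq 1 :: b | b <- compositions m.+1]
   ++ [seq (head 0 b).+1 :: behead b | b <- compositions m.+1] by [].
rewrite cat_uniq; apply/and3P; split.
- by rewrite map_inj_uniq // => b c [].
- apply/hasPn => x /mapP [b]; rewrite mem_compositions => /andP [cb /eqP sb] ->.
  by apply/mapP => -[c _]; case: b cb sb => [|[|y] s].
- rewrite map_inj_in_uniq // => b c; rewrite !mem_compositions.
  by case: b => [|x s]; case: c => [|y t] //= _ _ [-> ->].
Qed.

(* A formal power series in x_1, x_2, ... is given by its coefficients on     *)
(* monomials; a monomial is a finite multiset of variables, where j : nat     *)
(* stands for the variable x_(j+1).                                           *)
Definition series (F : fieldType) : Type := {mset nat}%mset -> F^o.

HB.instance Definition _ (F : fieldType) := GRing.Lmodule.on (series F).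

Section PeakAlgebra.
Variable F : fieldType.
Local Open Scope ring_scope.

(* The coefficient of the monomial m counts the sequences i_1 <= ... <= i_n   *)
(* satisfying the descent conditions whose product of variables is m.         *)
Definition fundQS (alpha : seq nat) : series F := fun m =>
  (count (fun s : seq nat =>
            [&& size s == sumn alpha, sorted leq s &
                all (fun j => (nth 0 s j.-1 < nth 0 s j)%N) (des alpha)])
         (permutations (enum_mset m)))%:R.

Definition peakK (alpha : seq nat) : series F :=
  (2 ^ (size (peak (des alpha))).+1)%:R *:
    \sum_(beta <- compositions (sumn alpha)
          | all (fun p => (p \in des beta) (+) (p \in [seq x.+1 | x <- des beta]))
                (peak (des alpha)))
       fundQS beta.

End PeakAlgebra.

Section Bases.
Variables (F : fieldType) (V : lmodType F) (I : eqType) (P : pred I).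
Variable v : I -> V.
Local Open Scope ring_scope.

Definition in_span (x : V) : Prop :=
  exists (s : seq I) (a : I -> F), all P s /\ x = \sum_(i <- s) a i *: v i.

Definition lin_indep : Prop :=
  forall (s : seq I) (a : I -> F), uniq s -> all P s ->
    \sum_(i <- s) a i *: v i = 0 -> forall i, i \in s -> a i = 0.

Definition is_basis (W : V -> Prop) : Prop :=
  [/\ forall i, P i -> W (v i), lin_indep & forall x, W x -> in_span x].

End Bases.

Definition peak_alg (F : fieldType) (f : series F) : Prop :=
  in_span is_peak_comp (@peakK F) f.

(* Modules over algebras presented by generators and relations are vector     *)
(* spaces with operators satisfying the relations.  Generators are numbered   *)
(* from 1 as usual; the operators attached to the other indices carry no      *)
(* information.                                                               *)
Section Modules.
Variables (F : fieldType) (n : nat).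
Local Open Scope ring_scope.

(* An H_n(0)-module, without the relations. *)
Record hecke_data := HeckeData {
  hk_space :> vectType F;
  hk_pi : nat -> 'End(hk_space)
}.

Record supermod := Supermod {
  sm_space :> vectType F;
  sm_even : {vspace sm_space};
  sm_odd : {vspace sm_space};
  sm_pi : nat -> 'End(sm_space);
  sm_c : nat -> 'End(sm_space);
  sm_full : (sm_even + sm_odd)%VS = fullv;
  sm_direct : (sm_even :&: sm_odd)%VS = 0%VS;
  sm_pi_even : forall i, (0 < i < n)%N -> (sm_pi i @: sm_even <= sm_even)%VS;
  sm_pi_odd : forall i, (0 < i < n)%N -> (sm_pi i @: sm_odd <= sm_odd)%VS;
  sm_c_even : forall j, (0 < j <= n)%N -> (sm_c j @: sm_even <= sm_odd)%VS;
  sm_c_odd : forall j, (0 < j <= n)%N -> (sm_c j @: sm_odd <= sm_even)%VS;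
  sm_pi_sq : forall i v, (0 < i < n)%N -> sm_pi i (sm_pi i v) = - sm_pi i v;
  sm_pi_comm : forall i j v, (0 < i < n)%N -> (0 < j < n)%N -> (i.+1 < j)%N ->
    sm_pi i (sm_pi j v) = sm_pi j (sm_pi i v);
  sm_pi_braid : forall i v, (0 < i)%N -> (i.+1 < n)%N ->
    sm_pi i (sm_pi i.+1 (sm_pi i v)) = sm_pi i.+1 (sm_pi i (sm_pi i.+1 v));
  sm_c_sq : forall j v, (0 < j <= n)%N -> sm_c j (sm_c j v) = - v;
  sm_c_anti : forall i j v, (0 < i <= n)%N -> (0 < j <= n)%N -> i != j ->
    sm_c i (sm_c j v) = - sm_c j (sm_c i v);
  sm_pi_c_comm : forall i j v, (0 < i < n)%N -> (0 < j <= n)%N ->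
    j != i -> j != i.+1 -> sm_pi i (sm_c j v) = sm_c j (sm_pi i v);
  sm_pi_c : forall i v, (0 < i < n)%N ->
    sm_pi i (sm_c i v) = sm_c i.+1 (sm_pi i v);
  sm_pi_cS : forall i v, (0 < i < n)%N ->
    sm_pi i (sm_c i.+1 v) + sm_c i.+1 v = sm_c i (sm_pi i v + v)
}.

Definition is_supermorph (M N : supermod) (f : 'Hom(M, N)) : Prop :=
  [/\ (f @: sm_even M <= sm_even N)%VS,
      (f @: sm_odd M <= sm_odd N)%VS,
      forall i v, (0 < i < n)%N -> f (sm_pi M i v) = sm_pi N i (f v) &
      forall j v, (0 < j <= n)%N -> f (sm_c M j v) = sm_c N j (f v)].

(* Homomorphisms of H_n(0)-modules from N, placed in degree 0, to the         *)
(* restriction of M.                                                          *)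
Definition is_hecke_morph (N : hecke_data) (M : supermod) (f : 'Hom(N, M)) :
    Prop :=
  (limg f <= sm_even M)%VS /\
  forall i v, (0 < i < n)%N -> f (hk_pi N i v) = sm_pi M i (f v).

(* The universal property of HCl_n(0) (x)_(H_n(0)) N.                         *)
Definition is_induced (N : hecke_data) (M : supermod) : Prop :=
  exists iota : 'Hom(N, M), is_hecke_morph iota /\
    forall (P : supermod) (f : 'Hom(N, P)), is_hecke_morph f ->
      exists! g : 'Hom(M, P),
        is_supermorph g /\ forall v, g (iota v) = f v.

Let Z : vectType F := 'rV[F]_0.

Let Z0 (u v : Z) : u = v.
Proof. by rewrite (thinmx0 u) (thinmx0 v). Qed.

Let Zfull : (0 + 0)%VS = fullv :> {vspace Z}.
Proof. by apply/vspaceP => u; rewrite (Z0 u 0) !mem0v. Qed.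

Let Zsub (f : 'End(Z)) : (f @: 0 <= 0)%VS.
Proof. by rewrite limg0. Qed.

Definition zero_supermod : supermod :=
  @Supermod Z 0%VS 0%VS (fun=> 0) (fun=> 0) Zfull (cap0v _)
    (fun _ _ => Zsub _) (fun _ _ => Zsub _) (fun _ _ => Zsub _)
    (fun _ _ => Zsub _) (fun _ _ _ => Z0 _ _) (fun _ _ _ _ _ _ => Z0 _ _)
    (fun _ _ _ _ => Z0 _ _) (fun _ _ _ => Z0 _ _) (fun _ _ _ _ _ _ => Z0 _ _)
    (fun _ _ _ _ _ _ _ => Z0 _ _) (fun _ _ _ => Z0 _ _) (fun _ _ _ => Z0 _ _).

(* The induced supermodule, unique up to isomorphism.  It exists for every    *)
(* H_n(0)-module N, as HCl_n(0) is finite-dimensional; the default value is   *)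
(* only there to make Ind total on data that might violate the relations.     *)
Definition Ind (N : hecke_data) : supermod :=
  if pselect (exists M, is_induced N M) is left ex then projT1 (cid ex)
  else zero_supermod.

End Modules.

Section Characteristic.
Variable F : fieldType.
Local Open Scope ring_scope.

Definition simpleH (alpha : seq nat) : hecke_data F :=
  @HeckeData F F^o (fun i => if i \in des alpha then - \1%VF else 0).

Definition Mind (alpha : seq nat) : supermod F (sumn alpha) :=
  Ind (sumn alpha) (simpleH alpha).

(* Maps on the Grothendieck groups of finite-dimensional supermodules are     *)
(* functions of supermodules that are additive on short exact sequences.      *)
Definition additive_on_ses (n : nat) (ch : supermod F n -> series F) : Prop :=
  forall (L M N : supermod F n) (f : 'Hom(L, M)) (g : 'Hom(M, N)),
    is_supermorph f -> is_supermorph g ->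
    lker f = 0%VS -> limg f = lker g -> limg g = fullv ->
    ch M = ch L + ch N.

(* The properties of the Bergeron-Hivert-Thibon isomorphism that determine    *)
(* its value on induced supermodules; its bijectivity (for coefficients in F) *)
(* is not needed, so it is not required.                                      *)
Definition is_peak_char (ch : forall n, supermod F n -> series F) : Prop :=
  [/\ forall n (M : supermod F n), peak_alg (ch n M),
      forall n, additive_on_ses (ch n) &
      forall alpha, is_comp alpha ->
        ch (sumn alpha) (Mind alpha) =
        peakK F (comp_of (sumn alpha) (peak (des alpha)))].

End Characteristic.

(* A diagram with a reading order is the list of its boxes (column, row) in   *)
(* reading order.  A standard filling T is represented by its reading word    *)
(* rw(T): the k-th entry of the word is the entry of the k-th box.            *)

Definition box : Type := (nat * nat)%type.

Definition fillings (n : nat) : seq (seq nat) := permutations (iota 1 n).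

Definition entry (D : seq box) (T : seq nat) (b : box) : nat :=
  nth 0 T (index b D).

Definition swap (i : nat) (T : seq nat) : seq nat :=
  [seq if e == i then i.+1 else if e == i.+1 then i else e | e <- T].

Definition desT (T : seq nat) : seq nat :=
  [seq i <- iota 1 (size T).-1 | index i.+1 T < index i T].

Section DiagramModule.
Variables (F : fieldType) (TT : seq (seq nat)).
Local Open Scope ring_scope.

Definition spanT : vectType F := {ffun seq_sub TT -> F^o}.

Definition basisT (T : seq nat) : spanT := [ffun S => (val S == T)%:R].

(* Meaningful for 0 < i < n.                                                  *)
Definition pi_basisT (i : nat) (T : seq nat) : spanT :=
  if i \in desT T then - basisT T
  else if swap i T \in TT then basisT (swap i T) else 0.

Definition diagH : hecke_data F :=
  @HeckeData F spanT (fun i => linfun (fun f : spanT =>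
    \sum_(S : seq_sub TT) (f S : F) *: pi_basisT i (val S))).

End DiagramModule.

(* Rows are numbered from 1, so row r of alpha has [nth 0 alpha r.-1] boxes.  *)
Definition in_diag (alpha : seq nat) (b : box) : bool :=
  (0 < b.2 <= size alpha) && (0 < b.1 <= nth 0 alpha b.2.-1).

Definition diag (alpha : seq nat) : seq box :=
  [seq b <- [seq (1, r) | r <- rev (iota 1 (size alpha))]
            ++ [seq (c, r) | c <- iota 2 (sumn alpha), r <- iota 1 (size alpha)]
   | in_diag alpha b].

Definition SYCT1 (D : seq box) (T : seq nat) : bool :=
  all (fun b => all (fun b' =>
    (b.2 == b'.2) && (b.1 < b'.1) ==> (entry D T b < entry D T b')) D) D.

Definition SYCT2 (D : seq box) (T : seq nat) : bool :=
  all (fun b => all (fun b' =>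
    [&& b.1 == 1, b'.1 == 1 & b.2 < b'.2] ==> (entry D T b < entry D T b')) D) D.

Definition SYCT3 (D : seq box) (T : seq nat) : bool :=
  all (fun b => all (fun b' =>
    [&& b'.1 == b.1.+1, b'.2 < b.2 & entry D T b < entry D T b'] ==>
    ((b.1.+1, b.2) \in D) && (entry D T (b.1.+1, b.2) < entry D T b')) D) D.

Definition SYCT (alpha : seq nat) : seq (seq nat) :=
  let D := diag alpha in
  [seq T <- fillings (sumn alpha) | [&& SYCT1 D T, SYCT2 D T & SYCT3 D T]].

Definition SPYCT (alpha : seq nat) : seq (seq nat) :=
  let D := diag alpha in
  [seq T <- SYCT alpha | all (fun k =>
    has (fun beta => is_peak_comp beta &&
                     perm_eq (diag beta) [seq b <- D | entry D T b <= k])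
        (compositions k)) (iota 1 (sumn alpha))].

Definition peakYQS (F : fieldType) (ch : forall n, supermod F n -> series F)
    (alpha : seq nat) : series F :=
  ch (sumn alpha) (Ind (sumn alpha) (diagH F (SPYCT alpha))).

Definition is_strict_part (lambda : seq nat) : bool :=
  is_comp lambda && sorted gtn lambda.

Definition shdiag (lambda : seq nat) : seq box :=
  [seq (c, r) | r <- rev (iota 1 (size lambda)),
                c <- iota r (nth 0 lambda r.-1)].

Definition SShT (lambda : seq nat) : seq (seq nat) :=
  let D := shdiag lambda in
  [seq T <- fillings (sumn lambda) | all (fun b => all (fun b' =>
    ((b.2 == b'.2) && (b.1 < b'.1)) || ((b.1 == b'.1) && (b.2 < b'.2)) ==>
    (entry D T b < entry D T b')) D) D].

Definition schurQ (F : fieldType) (lambda : seq nat) : series F :=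
  (\sum_(S <- SShT lambda) peakK F (comp_of (sumn lambda) (peak (desT S))))%R.

(* Main.v *)
(* Induction from H_n(0) to HCl_n(0) is exact, since the induced module is     *)
(* Cl_n (x) N as a vector space.  Filtering the diagram module of SPYCT(alpha) *)
(* by one-dimensional quotients therefore gives                                *)
(* S_alpha = sum_T K_(comp(Peak(T))).                                          *)
(* Let the weight of a subset X of [n-1] be the sum of n - p over p in X.      *)
(* Between the first entries of rows r and r+1 of T there is always a peak,    *)
(* and it is at most alpha_1 + ... + alpha_r; hence Peak(T) has weight at      *)
(* least that of Des(alpha), with equality only if Peak(T) = Des(alpha), which *)
(* happens for the row filling.  On the other hand, if the monomial x^alpha    *)
(* occurs in K_beta, then every element of Des(beta) is p or p+1 for some p in *)
(* Des(alpha), so that the weight of beta is at most that of alpha, with       *)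
(* equality only if beta = alpha.  So everything is triangular, and the        *)
(* S_alpha form a basis.                                                       *)
(* For a strict partition lambda, the triple rule and the peak rule together   *)
(* say exactly that moving row r by r-1 boxes to the right gives a standard    *)
(* shifted tableau, and the two reading orders give the same descents; so      *)
(* Q_lambda = S_lambda.                                                        *)

From HB Require Import structures.
Require Import Defs.
From mathcomp Require Import all_boot all_order all_algebra.
From mathcomp Require Import zify.
From mathcomp Require Import finmap multiset boolp functions complex reals.

Set Implicit Arguments.
Unset Strict Implicit.
Unset Printing Implicit Defensive.

Import GRing.Theory.

(** * Induction from H_n(0) to HCl_n(0) *)

(** Everything rests on one formula: for an ascent-compatible set of fillings, the characteristic of
    the induced diagram module is the sum of K_(comp(Peak(T))) over the fillings T ([ch_diagH]). It
    follows from additivity and the values on the [Mind alpha] once induction is exact. As [Ind] is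
    given by a universal property only, the supermodule Cl_n (x) N is built by hand ([MInd]) and
    shown to be induced ([MInd_induced]); exactness is then read off coordinate by coordinate
    ([ch_Ind_ses]). A filling that no other filling reaches by a nonattacking step spans a simple
    quotient, so fillings can be split off one at a time ([diagH_ses]). The formula applies to
    SPYCT(alpha), where an ascent i is attacking exactly when i and i+1 are neighbours in a row
    ([swap_SPYCT]).

    The basis property comes from two inequalities between weights of sets: wt(Des(beta)) <=
    wt(Peak(T)) for T in SPYCT(beta) ([SPYCT_peak_wt]), and wt(Peak(gamma)) <= wt(Des(alpha)) if
    x^alpha occurs in K_gamma ([kcoef_neq0]). The coefficients are natural numbers and the field has
    characteristic 0, so nothing cancels. Linear independence is an induction on the weight from
    below, spanning one from above ([peakYQS_lin_indep], [peakK_span]).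

    For strict lambda, Q_lambda and S_lambda are the same sum: shifting rows is a bijection between
    SPYCT(lambda) and SShT(lambda) ([SPYCT_strictP]), and it preserves descent sets although the
    reading orders differ ([desT_reread]). *)

Lemma linfun_linearE (F : fieldType) (U V : vectType F) (f : U -> V) :
  linear f -> forall u, linfun f u = f u.
Proof.
move=> lf u.
pose g : {linear U -> V} := HB.pack f (GRing.isLinear.Build F U V *:%R f lf).
exact: (lfunE g).
Qed.

(** * Index sets of Clifford monomials and their signs *)

Section SignedSets.
Variable n : nat.
Implicit Types (D E : {set 'I_n}) (i j k : nat).

(* Generators of the Clifford algebra are numbered from 1, elements of [D] from 0. *)
Definition memb D j : bool := [exists d in D, d.+1 == j].
Definition toggle j D : {set 'I_n} := [set d | (d \in D) (+) (d.+1 == j)].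
(** The sign of moving c_j from the left to its place in the increasing product c_D. At [j = n.+1]
    it is the parity of |D|, that is, the degree of c_D. *)
Definition sg D j : bool := \big[addb/false]_(k <- iota 1 n | k < j) memb D k.

Lemma membS D (d : 'I_n) : memb D d.+1 = (d \in D).
Proof.
apply/idP/idP => [|dD]; last by apply/exists_inP; exists d.
by case/exists_inP =>  e eD /eqP [ed]; rewrite -(_ : e = d) //; apply: val_inj.
Qed.

Lemma memb_toggle j D k : 0 < j <= n -> memb (toggle j D) k = memb D k (+) (k == j).
Proof.
case: j => // j /= jn.
case: (ltnP k.-1 n) => [kn|kn]; last first.
  have M0 E : memb E k = false.
    apply/exists_inP => -[d _ /eqP e].
    by move: kn; rewrite -e /= leqNgt ltn_ord.
  by rewrite !M0; apply/esym/negP => /eqP e; move: kn; rewrite e leqNgt jn.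
case: k kn => [|k] /= kn.
  have M0 E : memb E 0 = false by apply/exists_inP => -[d].
  by rewrite !M0.
by rewrite (membS _ (Ordinal kn)) inE (membS _ (Ordinal kn)).
Qed.

Lemma toggleK j D : toggle j (toggle j D) = D.
Proof. by apply/setP => d; rewrite !inE addbK. Qed.

Lemma toggleC i j D : toggle i (toggle j D) = toggle j (toggle i D).
Proof. by apply/setP => d; rewrite !inE addbAC. Qed.

Lemma memb_set0 j : memb set0 j = false.
Proof. by apply/exists_inP => -[d]; rewrite inE. Qed.

Lemma sg_set0 j : sg set0 j = false.
Proof. by apply: big1 => k _; rewrite memb_set0. Qed.

Lemma sg_toggle i D j : 0 < i <= n -> sg (toggle i D) j = sg D j (+) (i < j).
Proof.
move=> ir; rewrite /sg (eq_bigr (fun k => memb D k (+) (k == i))); last first.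
  by move=> k _; rewrite memb_toggle.
rewrite big_split /=; congr (_ (+) _).
have iI : i \in iota 1 n by rewrite mem_iota add1n ltnS.
rewrite big_mkcond (bigD1_seq i) ?iota_uniq //= eqxx big1 ?addbF; first by case: ifP.
by move=> k /negPf ->; case: ifP.
Qed.

Lemma sgS D i : 0 < i <= n -> sg D i.+1 = sg D i (+) memb D i.
Proof.
move=> ir; have iI : i \in iota 1 n by rewrite mem_iota add1n ltnS.
rewrite /sg big_mkcond (bigD1_seq i) ?iota_uniq //= ltnSn addbC; congr (_ (+) _).
rewrite [RHS]big_mkcond [RHS](bigD1_seq i) ?iota_uniq //= ltnn /=.
by apply: eq_bigr => k ki; rewrite ltnS leq_eqVlt (negPf ki).
Qed.

Lemma toggle_ind (Q : {set 'I_n} -> Prop) :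
  Q set0 -> (forall j D, 0 < j <= n -> Q D -> Q (toggle j D)) -> forall D, Q D.
Proof.
move=> Q0 QS D; have [m] := ubnP #|D|; elim: m D => // m IH D Dm.
have [->//|/set0Pn [d dD]] := eqVneq D set0.
rewrite -(toggleK d.+1 D); apply: QS; [exact: ltn_ord|apply: IH].
suff -> : toggle d.+1 D = D :\ d by rewrite (cardsD1 d) dD in Dm.
apply/setP => e; rewrite !inE eqSS -val_eqE /=.
by have [->|ed] := eqVneq e d; rewrite ?dD ?eqxx ?val_eqE ?(negPf ed) ?addbF.
Qed.

End SignedSets.

(** * An explicit induced supermodule on Cl_n (x) N *)

Section Induced.
Variables (F : fieldType) (n : nat).
Local Open Scope ring_scope.

Record hecke_rel (N : hecke_data F) : Prop := HeckeRel {
  hr_sq : forall i v, (0 < i < n)%N -> hk_pi N i (hk_pi N i v) = - hk_pi N i v;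
  hr_comm : forall i j v, (0 < i < n)%N -> (0 < j < n)%N -> (i.+1 < j)%N ->
    hk_pi N i (hk_pi N j v) = hk_pi N j (hk_pi N i v);
  hr_braid : forall i v, (0 < i)%N -> (i.+1 < n)%N ->
    hk_pi N i (hk_pi N i.+1 (hk_pi N i v)) =
    hk_pi N i.+1 (hk_pi N i (hk_pi N i.+1 v)) }.

Section Model.
Variable N : hecke_data F.

(** A function f stands for the sum over D of c_D (x) f(D), with c_D the product of the c_d, d in D,
    in increasing order. *)
Definition clN : vectType F := {ffun {set 'I_n} -> N}.

(** The coefficient at [D] comes from c_j c_E with E = [toggle j D]: c_j passes the smaller factors
    of c_E with one sign each and, if j is in E, meets itself with c_j^2 = -1. As j lies in exactly
    one of D and E, the test on E appears as [~~ memb D j]. *)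
Definition cl_fun j (f : clN) : clN :=
  [ffun D => (-1) ^+ (sg D j (+) ~~ memb D j) *: f (toggle j D)].

(* Moving pi_i to the right of c_D with the defining relations only changes   *)
(* the factors c_i, c_(i+1) of c_D, e.g.                                      *)
(* pi_i c_i c_(i+1) = - c_i c_(i+1) (pi_i + 1) + 1.                           *)
Definition pi_fun i (f : clN) : clN :=
  [ffun D : {set 'I_n} => let E := toggle i (toggle i.+1 D) in
    if memb D i then
      if memb D i.+1 then - (hk_pi N i (f D) + f D) else hk_pi N i (f E) + f E
    else
      if memb D i.+1 then hk_pi N i (f E) - f D else hk_pi N i (f D) + f E].

Definition delta (D : {set 'I_n}) (v : N) : clN := [ffun E => if E == D then v else 0].

Lemma cl_fun_linear j : linear (cl_fun j).
Proof.
move=> a f g; apply/ffunP => D; rewrite !ffunE scalerDr !scalerA.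
by congr (_ *: _ + _); rewrite mulrC.
Qed.

Lemma pi_fun_linear i : linear (pi_fun i).
Proof.
move=> a f g; apply/ffunP => D; rewrite !ffunE /= !ffunE.
by case: ifP => _; case: ifP => _; rewrite linearP /= ?opprD ?scalerDr ?scalerN ?opprD
   ?[(_ + f _) + _]addrA addrACA ?scalerDr ?scalerN.
Qed.

Lemma delta_linear D : linear (delta D).
Proof. by move=> a u v; apply/ffunP => E; rewrite !ffunE; case: ifP; rewrite // scaler0 addr0. Qed.

Definition cl_c j : 'End(clN) := linfun (cl_fun j).
Definition cl_pi i : 'End(clN) := linfun (pi_fun i).

Lemma cl_cE j f : cl_c j f = cl_fun j f.
Proof. exact: linfun_linearE (@cl_fun_linear j) _. Qed.
Lemma cl_piE i f : cl_pi i f = pi_fun i f.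
Proof. exact: linfun_linearE (@pi_fun_linear i) _. Qed.

Lemma cl_cEf j (f : clN) D :
  cl_c j f D = (-1) ^+ (sg D j (+) ~~ memb D j) *: f (toggle j D).
Proof. by rewrite cl_cE ffunE. Qed.

Lemma cl_piEf i (f : clN) D : cl_pi i f D =
  let E := toggle i (toggle i.+1 D) in
    if memb D i then
      if memb D i.+1 then - (hk_pi N i (f D) + f D) else hk_pi N i (f E) + f E
    else
      if memb D i.+1 then hk_pi N i (f E) - f D else hk_pi N i (f D) + f E.
Proof. by rewrite cl_piE ffunE. Qed.

Lemma cl_c_delta j D v : (0 < j <= n)%N ->
  cl_c j (delta D v) = (-1) ^+ (sg D j (+) memb D j) *: delta (toggle j D) v.
Proof.
move=> jr; rewrite cl_cE; apply/ffunP => E; rewrite !ffunE.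
have -> : (toggle j E == D) = (E == toggle j D).
  by apply/eqP/eqP => [<-|->]; rewrite toggleK.
case: eqP => [->|_]; last by rewrite !scaler0.
by rewrite sg_toggle // memb_toggle // ltnn eqxx addbF addbT negbK.
Qed.

Lemma cl_sum_delta (f : clN) : f = \sum_D delta D (f D).
Proof.
apply/ffunP => E; rewrite sum_ffunE (bigD1 E) //= ffunE eqxx big1 ?addr0 //.
by move=> D DE; rewrite ffunE eq_sym (negPf DE).
Qed.

(** The c_j generate the supermodule from 1 (x) N. A relation can thus be checked on N and carried
    past one c_j at a time, without the four-case formula of [pi_fun]. *)
Lemma cl_ind (Q : clN -> Prop) :
  (forall v, Q (delta set0 v)) -> (forall x y, Q x -> Q y -> Q (x + y)) ->
  (forall j x, (0 < j <= n)%N -> Q x -> Q (cl_c j x)) -> forall x, Q x.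
Proof.
move=> Q1 QD Qc x; rewrite (cl_sum_delta x).
elim/big_ind: _ => // [|D _].
  by have -> : 0 = delta set0 0 by apply/ffunP => D; rewrite !ffunE; case: ifP.
move: (x D) => v; elim/toggle_ind: D v => [//|j D jr IH v].
have := Qc j _ jr (IH ((-1) ^+ (sg D j (+) memb D j) *: v)).
rewrite cl_c_delta //; congr Q; apply/ffunP => E; rewrite !ffunE.
by case: ifP => _; rewrite ?scaler0 // scalerA -signr_addb addbb scale1r.
Qed.

Lemma cl_c_sq j x : (0 < j <= n)%N -> cl_c j (cl_c j x) = - x.
Proof.
move=> jr; rewrite !cl_cE; apply/ffunP => D; rewrite !ffunE toggleK scalerA.
rewrite -signr_addb sg_toggle // memb_toggle // ltnn eqxx addbF addbT negbK.
by case: (sg _ _); case: (memb _ _); rewrite /= scaleN1r.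
Qed.

Lemma cl_c_anti i j x : (0 < i <= n)%N -> (0 < j <= n)%N -> i != j ->
  cl_c i (cl_c j x) = - cl_c j (cl_c i x).
Proof.
move=> ir jr ij; rewrite !cl_cE; apply/ffunP => D; rewrite !ffunE toggleC !scalerA.
rewrite -!signr_addb -scaleNr; congr (_ *: _).
rewrite !sg_toggle // !memb_toggle // [j == i]eq_sym (negPf ij) !addbF.
case: (ltngtP i j) ij => // _ _; case: (sg D i); case: (sg D j);
  by case: (memb D i); case: (memb D j); rewrite /= ?expr0 ?expr1 ?opprK.
Qed.

Lemma cl_pi_c_comm i j x : (0 < i < n)%N -> (0 < j <= n)%N -> j != i -> j != i.+1 ->
  cl_pi i (cl_c j x) = cl_c j (cl_pi i x).
Proof.
move=> /andP [i0 iN] jr ji jSi.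
have ir : (0 < i <= n)%N by rewrite i0 ltnW.
apply/ffunP => D; rewrite cl_cEf !cl_piEf /= !cl_cEf !memb_toggle //.
rewrite [i == j]eq_sym (negPf ji) [i.+1 == j]eq_sym (negPf jSi) !addbF !sg_toggle //.
have -> : (i < j)%N = (i.+1 < j)%N by rewrite [RHS]ltn_neqAle eq_sym jSi.
rewrite addbK ?addbF !(toggleC j); case: (memb D i); case: (memb D i.+1);
   by rewrite /= ?linearZ_LR /= ?scalerN ?scalerDr ?scalerN.
Qed.

Lemma cl_pi_c i x : (0 < i < n)%N -> cl_pi i (cl_c i x) = cl_c i.+1 (cl_pi i x).
Proof.
move=> /andP [i0 iN].
have ir : (0 < i <= n)%N by rewrite i0 ltnW.
have si : (i.+1 == i) = false by rewrite eqn_leq ltnn.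
have iSn : (i == i.+1) = false by rewrite eq_sym.
apply/ffunP => D; rewrite cl_cEf !cl_piEf /= !cl_cEf !memb_toggle //.
rewrite !eqxx ?si ?iSn !sg_toggle // sgS // !ltnn ltnNge leqnSn /= !addbF !addbT.
rewrite !toggleK.
by case: (sg D i); case: (memb D i); case: (memb D i.+1);
  rewrite /= ?expr0 ?expr1 ?scale1r ?scaleN1r ?linearN ?opprD ?opprK.
Qed.

Lemma cl_pi_cS i x : (0 < i < n)%N ->
  cl_pi i (cl_c i.+1 x) + cl_c i.+1 x = cl_c i (cl_pi i x + x).
Proof.
move=> /andP [i0 iN].
have ir : (0 < i <= n)%N by rewrite i0 ltnW.
have si : (i.+1 == i) = false by rewrite eqn_leq ltnn.
have iSn : (i == i.+1) = false by rewrite eq_sym.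
apply/ffunP => D; rewrite cl_cEf !ffunE !cl_piEf /= !cl_cEf !memb_toggle //.
rewrite !eqxx ?si ?iSn !sg_toggle // sgS // !ltnn ltnSn ?memb_toggle //= !addbF !addbT.
rewrite ?eqxx ?iSn ?(toggleC i.+1 i) ?toggleK.
case: (sg D i); case: (memb D i); case: (memb D i.+1);
  rewrite /= ?expr0 ?expr1 ?scale1r ?scaleN1r ?linearN ?opprD ?opprK /=.
all: by rewrite ?addrK ?subrK // addrAC.
Qed.

Lemma cl_pi_cS' i x : (0 < i < n)%N ->
  cl_pi i (cl_c i.+1 x) = cl_c i (cl_pi i x) + cl_c i x - cl_c i.+1 x.
Proof. by move=> ir; apply: (@addIr _ (cl_c i.+1 x)); rewrite subrK cl_pi_cS // linearD. Qed.

Lemma cl_pi_delta0 i v : (0 < i < n)%N ->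
  cl_pi i (delta set0 v) = delta set0 (hk_pi N i v).
Proof.
move=> /andP [i0 iN]; have ir : (0 < i <= n)%N by rewrite i0 ltnW.
apply/ffunP => D; rewrite cl_piEf ffunE /= ![delta _ _ _]ffunE.
have M (E : {set 'I_n}) j : memb E j -> (E == set0) = false.
  by move=> Ej; apply/eqP => E0; rewrite E0 memb_set0 in Ej.
have E1 : memb D i = false -> (toggle i (toggle i.+1 D) == set0) = false.
  move=> Di; apply: (M _ i); rewrite !memb_toggle // Di eqxx eqn_leq ltnn andbF.
  by [].
have E2 : memb D i.+1 = false -> (toggle i (toggle i.+1 D) == set0) = false.
  move=> Di; apply: (M _ i.+1); rewrite !memb_toggle // Di eqxx.
  by rewrite eqn_leq ltnn.
have E0 : ~~ (memb D i && memb D i.+1) -> (toggle i (toggle i.+1 D) == set0) = false.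
  by rewrite negb_and => /orP [/negbTE /E1|/negbTE /E2].
case e1: (memb D i); case e2: (memb D i.+1); rewrite ?E0 ?e1 ?e2 //.
- by rewrite (M _ i) //= linear0 addr0 oppr0.
- by rewrite (M _ i) //= linear0 addr0.
- by rewrite (M _ i.+1) //= linear0 subr0.
- by case: ifP => _; rewrite ?linear0 addr0.
Qed.

Hypothesis HN : hecke_rel N.

(* The relations between the pi_i hold on 1 (x) N, and each of them is        *)
(* inherited from x by c_j x for all j.                                       *)
Lemma cl_pi_sq i x : (0 < i < n)%N -> cl_pi i (cl_pi i x) = - cl_pi i x.
Proof.
move=> ir; elim/cl_ind: x => [v|x y Hx Hy|j x jr H].
- by rewrite !cl_pi_delta0 // hr_sq //; apply/ffunP => D; rewrite !ffunE; case: ifP; rewrite ?oppr0.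
- by rewrite !linearD /= Hx Hy.
have [->|ji] := eqVneq j i.
  by rewrite cl_pi_c // cl_pi_cS' // H linearN /= addNr add0r.
have [->|jSi] := eqVneq j i.+1; last by rewrite !cl_pi_c_comm // H linearN.
rewrite cl_pi_cS' // !linearB !linearD /= cl_pi_cS' // !cl_pi_c // H linearN /=.
by rewrite addNr add0r !opprD.
Qed.

Lemma cl_pi_comm i j x : (0 < i < n)%N -> (0 < j < n)%N -> (i.+1 < j)%N ->
    cl_pi i (cl_pi j x) = cl_pi j (cl_pi i x).
Proof.
move=> ir jr ij.
have ji : (i == j) = false by apply/eqP => e; move: ij; rewrite e; lia.
have Sij : (i.+1 == j) = false by apply/eqP => e; move: ij; rewrite e; lia.
have iSj : (i == j.+1) = false by apply/eqP => e; move: ij; rewrite e; lia.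
have ij' : (j == i) = false by rewrite eq_sym.
have Sij' : (j == i.+1) = false by rewrite eq_sym.
have iSj' : (j.+1 == i) = false by rewrite eq_sym.
have ir' : (0 < i <= n)%N by lia.
have jr' : (0 < j <= n)%N by lia.
have ir'' : (0 < i.+1 <= n)%N by lia.
have jr'' : (0 < j.+1 <= n)%N by lia.
elim/cl_ind: x => [v|x y Hx Hy|k x kr H].
- by rewrite !cl_pi_delta0 // hr_comm.
- by rewrite !linearD /= Hx Hy.
have [->|ki] := eqVneq k i.
  by rewrite !(@cl_pi_c_comm j) ?ji ?iSj // !cl_pi_c // (@cl_pi_c_comm j) ?Sij ?eqSS ?ji // H.
have [->|kSi] := eqVneq k i.+1.
  rewrite (@cl_pi_c_comm j) ?Sij ?eqSS ?ji // !cl_pi_cS' // H.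
  by rewrite !linearB !linearD /= !(@cl_pi_c_comm j) ?Sij ?ji ?iSj ?eqSS ?ji.
have [->|kj] := eqVneq k j.
  by rewrite cl_pi_c // !(@cl_pi_c_comm i) ?ij' ?iSj' ?Sij' ?eqSS ?ij' // cl_pi_c // -H.
have [->|kSj] := eqVneq k j.+1; last by rewrite !cl_pi_c_comm // H.
rewrite cl_pi_cS' // (@cl_pi_c_comm i j.+1) ?eqSS ?ij' ?iSj' // cl_pi_cS' // -H.
by rewrite !linearB !linearD /= !(@cl_pi_c_comm i) ?Sij' ?ij' ?iSj' ?eqSS ?ij' //.
Qed.

Lemma cl_pi_braid i x : (0 < i)%N -> (i.+1 < n)%N ->
    cl_pi i (cl_pi i.+1 (cl_pi i x)) = cl_pi i.+1 (cl_pi i (cl_pi i.+1 x)).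
Proof.
move=> i0 iN.
have ir : (0 < i < n)%N by lia.
have jr : (0 < i.+1 < n)%N by lia.
have ir1 : (0 < i <= n)%N by lia.
have ir2 : (0 < i.+1 <= n)%N by lia.
have ir3 : (0 < i.+2 <= n)%N by lia.
have n1 : i != i.+1 by lia.
have n2 : i != i.+2 by lia.
have n3 : i.+2 != i by lia.
have n4 : i.+2 != i.+1 by lia.
have n5 : i.+1 != i.+2 by lia.
elim/cl_ind: x => [v|x y Hx Hy|k x kr H].
- by rewrite !cl_pi_delta0 // hr_braid.
- by rewrite !linearD /= Hx Hy.
have [->|ki] := eqVneq k i.
  rewrite cl_pi_c // cl_pi_c // cl_pi_c_comm // H.
  by rewrite cl_pi_c_comm // cl_pi_c // cl_pi_c.
have [->|k1] := eqVneq k i.+1.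
  rewrite cl_pi_cS' // [cl_pi i.+1 (cl_c _ _)]cl_pi_c // cl_pi_c_comm // cl_pi_cS' //.
  by rewrite !linearB !linearD /= !(@cl_pi_c_comm i.+1 i) // !cl_pi_c // !cl_pi_c_comm // H.
(* Moving c_(i+2) to the left creates words in which a pi is repeated; the quadratic relation
   reduces them, and the leftovers [u] and [v] cancel. *)
have [->|k2] := eqVneq k i.+2; last by rewrite !cl_pi_c_comm // H.
have Q1 := cl_pi_cS' _ ir; have Q2 := cl_pi_cS' _ jr.
have C1 y : cl_pi i (cl_c i.+2 y) = cl_c i.+2 (cl_pi i y) by rewrite cl_pi_c_comm.
have C2 y : cl_pi i.+1 (cl_c i y) = cl_c i (cl_pi i.+1 y) by rewrite cl_pi_c_comm.
have C3 y : cl_pi i (cl_c i y) = cl_c i.+1 (cl_pi i y) by rewrite cl_pi_c.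
have C4 y : cl_pi i.+1 (cl_c i.+1 y) = cl_c i.+2 (cl_pi i.+1 y) by rewrite cl_pi_c.
rewrite C1 Q2 !linearB !linearD /= Q1 C1 Q2 !linearB !linearD /= !(Q1, C1, C2, C3, C4, Q2).
rewrite !linearB !linearD /= !(Q1, C1, C2, C3, C4, Q2) !cl_pi_sq // H !linearN /=.
rewrite !opprK; set a := cl_c i (cl_pi _ (cl_pi _ (cl_pi _ _))).
set b := cl_c i (cl_pi _ (cl_pi _ _)); set c := cl_c i.+1 (cl_pi _ (cl_pi _ _)).
set d := cl_c i (cl_pi i x); set e := cl_c i.+1 (cl_pi i x); set g := cl_c i.+2 (cl_pi i x).
set u := cl_c i (cl_pi i.+1 x); set v := cl_c i.+2 (cl_pi i.+1 x).
rewrite addNr add0r -[a - u + v]addrA -[b + u - v]addrA [(a + _) + (b + _)]addrACA.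
have -> : - u + v + (u - v) = 0 by rewrite addrACA addNr subrr addr0.
by rewrite addr0 !addrA.
Qed.

Definition cl_keep (b : bool) (f : clN) : clN :=
  [ffun D => if sg D n.+1 == b then f D else 0].

Lemma cl_keep_linear b : linear (cl_keep b).
Proof.
move=> a f g; apply/ffunP => D; rewrite !ffunE.
by case: ifP; rewrite ?ffunE // scaler0 addr0.
Qed.

(** The functions supported on sets of parity [b]; describing them as the kernel of the projection
    to the other parity makes them a subspace at once. *)
Definition cl_part (b : bool) : {vspace clN} := lker (linfun (cl_keep (~~ b))).

Lemma cl_partP b (x : clN) : reflect (forall D, sg D n.+1 != b -> x D = 0) (x \in cl_part b).
Proof.
rewrite memv_ker (linfun_linearE (@cl_keep_linear _)).
apply: (iffP eqP) => [/ffunP x0 D Db|x0].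
  by have := x0 D; rewrite !ffunE; move: Db; case: (sg _ _); case: (b).
by apply/ffunP => D; rewrite !ffunE; case: eqP => // Db; apply: x0; rewrite Db; case: (b).
Qed.

Lemma cl_part_full : (cl_part false + cl_part true)%VS = fullv.
Proof.
apply/vspaceP => x; rewrite memvf; have -> : x = cl_keep false x + cl_keep true x.
  by apply/ffunP => D; rewrite !ffunE; case: (sg _ _); rewrite ?add0r ?addr0.
by apply: memv_add; apply/cl_partP => D; rewrite !ffunE => /negbTE ->.
Qed.

Lemma cl_part_direct : (cl_part false :&: cl_part true)%VS = 0%VS.
Proof.
apply/vspaceP => x; rewrite memv_cap memv0; apply/andP/eqP => [[/cl_partP x0 /cl_partP x1]|->].
  apply/ffunP => D; rewrite ffunE.
  by case e: (sg D n.+1); [apply: x0|apply: x1]; rewrite e.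
by rewrite !mem0v.
Qed.

Lemma cl_pi_part b i : (0 < i < n)%N -> (cl_pi i @: cl_part b <= cl_part b)%VS.
Proof.
move=> /andP [i0 iN]; have ir : (0 < i <= n)%N by rewrite i0 ltnW.
apply/subvP => _ /memv_imgP [x /cl_partP xb ->]; apply/cl_partP => D Db.
have Db' : sg (toggle i (toggle i.+1 D)) n.+1 != b.
  by rewrite !sg_toggle // !ltnS (andP ir).2 iN addbK.
by rewrite cl_piEf /= !xb // linear0 addr0 subr0 oppr0; do 2 case: ifP.
Qed.

Lemma cl_c_part b j : (0 < j <= n)%N -> (cl_c j @: cl_part b <= cl_part (~~ b))%VS.
Proof.
move=> jr; apply/subvP => _ /memv_imgP [x /cl_partP xb ->]; apply/cl_partP => D Db.
rewrite cl_cEf xb ?scaler0 // sg_toggle // ltnS (andP jr).2 addbT.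
by move: Db; case: (sg _ _); case: (b).
Qed.

Definition MInd : supermod F n :=
  @Supermod F n clN (cl_part false) (cl_part true) cl_pi cl_c cl_part_full cl_part_direct
    (@cl_pi_part false) (@cl_pi_part true) (@cl_c_part false) (@cl_c_part true)
    cl_pi_sq cl_pi_comm cl_pi_braid cl_c_sq cl_c_anti cl_pi_c_comm cl_pi_c cl_pi_cS.

End Model.
End Induced.

(** * Exactness of induction *)

Section Universal.
Variables (F : fieldType) (n : nat) (N : hecke_data F) (HN : hecke_rel n N).
Variables (P : supermod F n) (phi : 'Hom(N, P)).
Hypothesis phiM : is_hecke_morph phi.
Local Open Scope ring_scope.

(** For [l = iota 1 n] this is c_D p; general [l] serves the inductions. *)
Definition cl_word (l : seq nat) (D : {set 'I_n}) (p : P) : P :=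
  foldr (fun j x => if memb D j then sm_c P j x else x) p l.

Lemma cl_word_linear l D : linear (cl_word l D).
Proof.
move=> a u v; elim: l => //= k l ->; case: ifP => // _.
by rewrite linearP.
Qed.

Lemma cl_word_toggle l j D p : all (fun k => k != j) l -> (0 < j <= n)%N ->
  cl_word l (toggle j D) p = cl_word l D p.
Proof.
move=> + jr; elim: l => //= k l IH /andP [kj lj].
by rewrite IH // memb_toggle // (negPf kj) addbF.
Qed.

(** The sign rule of [cl_fun] inside an arbitrary supermodule: c_j anticommutes with the factors
    before its place, and there it is either inserted or squares to -1. *)
Lemma c_cl_word l j D p : sorted ltn l -> all (fun k => 0 < k <= n)%N l -> j \in l ->
  sm_c P j (cl_word l D p) =
  (-1) ^+ ((\big[addb/false]_(k <- l | (k < j)%N) memb D k) (+) memb D j)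
    *: cl_word l (toggle j D) p.
Proof.
elim: l => //= k l IH kl /andP [kr lr]; have ls := path_sorted kl.
have lk : all (ltn k) l by move: kl; rewrite path_sortedE => [/andP []|]; last exact: ltn_trans.
rewrite inE big_cons; case: (ltngtP j k) => /= [jk|kj|jk]; last subst k.
- by move=> /(allP lk) /=; rewrite ltnNge ltnW.
- move=> jl; have jr := allP lr _ jl.
  rewrite memb_toggle // eq_sym gtn_eqF // addbF; case: ifP => _; last exact: IH.
  rewrite sm_c_anti // ?gtn_eqF // IH //= linearZ /= -scaleNr addNb.
  by case: (_ (+) _); rewrite ?opprK.
- move=> _; have jr := kr.
  rewrite big1_seq; last first.
    by move=> i /andP [ij /(allP lk)] /=; rewrite ltnNge ltnW.
  rewrite memb_toggle // eqxx addbT cl_word_toggle //; last first.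
    by apply/allP => i /(allP lk) /= ji; rewrite gtn_eqF.
  by case: (memb D j); rewrite /= ?sm_c_sq // ?scaleN1r ?scale1r.
Qed.

Lemma cl_word_parity l D p : all (fun k => 0 < k <= n)%N l -> p \in sm_even P ->
  cl_word l D p \in if \big[addb/false]_(k <- l) memb D k then sm_odd P else sm_even P.
Proof.
move=> + pe; elim: l => [|k l IH] /=; first by rewrite big_nil.
move=> /andP [kr /IH {}IH]; rewrite big_cons; case: ifP => _ //=.
have H := memv_img (sm_c P k) IH.
by case: (\big[_/_]_(_ <- _) _) H => /= H;
  [apply: (subvP (sm_c_odd P kr))|apply: (subvP (sm_c_even P kr))].
Qed.

(** The only possible extension of [phi]: c_D (x) v must go to c_D phi(v). *)
Definition cl_lift_fun (f : clN n N) : P := \sum_D cl_word (iota 1 n) D (phi (f D)).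

Lemma cl_lift_linear : linear cl_lift_fun.
Proof.
move=> a u v; rewrite /cl_lift_fun scaler_sumr -big_split; apply: eq_bigr => D _ /=.
by rewrite !ffunE linearP cl_word_linear.
Qed.

Definition cl_lift : 'Hom(MInd HN, P) := linfun (cl_lift_fun : MInd HN -> P).

Lemma cl_liftE f : cl_lift f = cl_lift_fun f.
Proof. exact: linfun_linearE cl_lift_linear _. Qed.

Lemma iota_range : all (fun k => 0 < k <= n)%N (iota 1 n).
Proof. by apply/allP => k; rewrite mem_iota add1n ltnS. Qed.

Lemma cl_lift0 v : cl_lift (delta set0 v) = phi v.
Proof.
rewrite cl_liftE /cl_lift_fun (bigD1 set0) //= ffunE eqxx big1 ?addr0.
  by elim: (iota 1 n) => //= k l ->; rewrite memb_set0.
move=> D /negbTE D0; rewrite ffunE D0 linear0.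
by elim: (iota 1 n) => //= k l ->; rewrite linear0 if_same.
Qed.

Lemma cl_lift_c j f : (0 < j <= n)%N -> cl_lift (sm_c (MInd HN) j f) = sm_c P j (cl_lift f).
Proof.
move=> jr; rewrite !cl_liftE /cl_lift_fun linear_sum /=.
rewrite (reindex_inj (can_inj (@toggleK n j))); apply: eq_bigr => D _ /=.
have jI : j \in iota 1 n by rewrite mem_iota add1n ltnS.
rewrite c_cl_word ?iota_ltn_sorted ?iota_range //.
rewrite cl_cEf toggleK sg_toggle // memb_toggle // ltnn eqxx addbF addbT negbK.
rewrite -/(sg D j); have := cl_word_linear (iota 1 n) (toggle j D).
move=> L; rewrite linearZ /=; have := L ((-1) ^+ (sg D j (+) memb D j)) (phi (f D)) 0.
have -> : cl_word (iota 1 n) (toggle j D) 0 = 0.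
  by have := L 1 0 0; rewrite scaler0 addr0 scale1r => /esym/eqP; rewrite -subr_eq0 addrK => /eqP.
by rewrite !addr0.
Qed.

(** Compatibility with pi_i holds on 1 (x) N by hypothesis on [phi], and passes from x to c_j x
    because the same relations between pi_i and c_j hold in both supermodules. *)
Lemma cl_lift_supermorph : is_supermorph cl_lift.
Proof.
have [phie phip] := phiM.
have phi_even v : phi v \in sm_even P by apply: (subvP phie); rewrite memv_img ?memvf.
have W0 D : cl_word (iota 1 n) D (phi 0) = 0.
  by rewrite linear0; elim: (iota 1 n) => //= k l ->; rewrite linear0 if_same.
have sgE (D : {set 'I_n}) : sg D n.+1 = \big[addb/false]_(k <- iota 1 n) memb D k.
  rewrite /sg big_mkcond [LHS]big_seq [RHS]big_seq; apply: eq_bigr => k; rewrite mem_iota add1n ltnS.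
  by case/andP => _ ->.
split.
- apply/subvP => _ /memv_imgP [x /cl_partP xe ->]; rewrite cl_liftE; apply: memv_suml => D _.
  have := cl_word_parity D iota_range (phi_even (x D)); rewrite -sgE.
  by case e: (sg D n.+1) => //; rewrite xe ?W0 ?mem0v ?e.
- apply/subvP => _ /memv_imgP [x /cl_partP xe ->]; rewrite cl_liftE; apply: memv_suml => D _.
  have := cl_word_parity D iota_range (phi_even (x D)); rewrite -sgE.
  by case e: (sg D n.+1) => //; rewrite xe ?W0 ?mem0v ?e.
- move=> i v ir; have [i0 iN] := andP ir; have ir' : (0 < i <= n)%N by rewrite i0 ltnW.
  elim/cl_ind: v => [v|x y Hx Hy|j x jr H]; first by rewrite /= cl_pi_delta0 // !cl_lift0 phip.
    by rewrite !linearD /= Hx Hy.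
  rewrite -[@cl_c _ n N j x]/(sm_c (MInd HN) j x).
  have [->|ji] := eqVneq j i.
    by rewrite sm_pi_c // !cl_lift_c // H sm_pi_c.
  have [->|jSi] := eqVneq j i.+1; last by rewrite sm_pi_c_comm // !cl_lift_c // H sm_pi_c_comm.
  have -> : sm_pi (MInd HN) i (sm_c (MInd HN) i.+1 x) =
      sm_c (MInd HN) i (sm_pi (MInd HN) i x + x) - sm_c (MInd HN) i.+1 x.
    by rewrite -sm_pi_cS // addrK.
  transitivity (cl_lift (sm_c (MInd HN) i (sm_pi (MInd HN) i x + x))
      - cl_lift (sm_c (MInd HN) i.+1 x)); first exact: linearB.
  rewrite !cl_lift_c //.
  have -> : cl_lift (sm_pi (MInd HN) i x + x) = cl_lift (sm_pi (MInd HN) i x) + cl_lift x.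
    exact: linearD.
  by rewrite H -sm_pi_cS // addrK.
- by move=> j v jr; apply: cl_lift_c.
Qed.

Lemma cl_lift_unique (g : 'Hom(MInd HN, P)) :
  is_supermorph g -> (forall v, g (delta set0 v) = phi v) -> cl_lift = g.
Proof.
move=> [_ _ _ gc] g0; apply/lfunP => x.
elim/cl_ind: x => [v|x y Hx Hy|j x jr H]; first by rewrite cl_lift0 g0.
  have LD (h : 'Hom(MInd HN, P)) : h (x + y) = h x + h y by exact: linearD.
  by rewrite !LD Hx Hy.
by rewrite -[@cl_c _ n N j x]/(sm_c (MInd HN) j x) cl_lift_c // gc // H.
Qed.

End Universal.

Lemma MInd_induced (F : fieldType) n (N : hecke_data F) (HN : hecke_rel n N) :
  is_induced N (MInd HN).
Proof.
pose iota : 'Hom(N, MInd HN) := linfun (delta set0 : N -> MInd HN).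
have iotaE v : iota v = delta set0 v by exact: linfun_linearE (@delta_linear _ _ _ _) _.
exists iota; split; first split.
- apply/subvP => _ /memv_imgP [v _ ->]; rewrite iotaE; apply/cl_partP => D De.
  by rewrite ffunE; case: eqP => // D0; rewrite D0 sg_set0 in De.
- by move=> i v ir; rewrite !iotaE /= cl_pi_delta0.
move=> P f fM; exists (cl_lift HN f); split.
  by split; [exact: cl_lift_supermorph|move=> v; rewrite iotaE cl_lift0].
by move=> g [gM gf]; apply: cl_lift_unique => // v; rewrite -iotaE.
Qed.

(** * Additive functions on induced supermodules *)

Section CharExact.
Variables (F : fieldType) (n : nat) (ch : supermod F n -> series F).
Hypothesis ch_add : additive_on_ses ch.
Local Open Scope ring_scope.

(** The zero maps M -> M -> M form a short exact sequence, so ch M = ch M + ch M. *)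
Lemma ch_zero (M : supermod F n) : (forall v : M, v = 0) -> ch M = 0.
Proof.
move=> M0.
have V0 (U : {vspace M}) : U = 0%VS by apply/vspaceP => v; rewrite (M0 v) !mem0v.
have z0 : is_supermorph (0 : 'Hom(M, M)).
  by split; rewrite ?(V0 (_ @: _)%VS) ?sub0v // => *; rewrite !lfunE /= ?linear0.
have := @ch_add M M M 0 0 z0 z0 (V0 _).
rewrite (V0 (limg _)) (V0 (lker _)) (V0 fullv) => /(_ erefl erefl) /eqP.
by rewrite -subr_eq0 opprD addrA subrr sub0r oppr_eq0 => /eqP.
Qed.

Lemma supermorph_id (M : supermod F n) : is_supermorph (\1%VF : 'End(M)).
Proof. by split; rewrite ?lim1g // => *; rewrite !lfunE. Qed.

Lemma supermorph_comp (M N P : supermod F n) (g : 'Hom(N, P)) (f : 'Hom(M, N)) :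
  is_supermorph g -> is_supermorph f -> is_supermorph (g \o f)%VF.
Proof.
move=> [ge go gp gc] [fe fo fp fc]; split.
- by rewrite limg_comp (subv_trans (limgS _ fe)).
- by rewrite limg_comp (subv_trans (limgS _ fo)).
- by move=> i v ir; rewrite !lfunE /= fp // gp.
- by move=> i v ir; rewrite !lfunE /= fc // gc.
Qed.

Lemma ch_iso (M N : supermod F n) (f : 'Hom(M, N)) (g : 'Hom(N, M)) :
  is_supermorph f -> cancel f g -> cancel g f -> ch M = ch N.
Proof.
move=> fM fK gK; pose Z := zero_supermod F n.
have Z0 (v : Z) : v = 0 by exact: thinmx0.
have zM : is_supermorph (0 : 'Hom(Z, M)).
  split; try by apply/subvP => _ /memv_imgP [v _ ->]; rewrite lfunE /= mem0v.
    by move=> *; rewrite !lfunE /= linear0.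
  by move=> *; rewrite !lfunE /= linear0.
rewrite (ch_add zM fM) ?(ch_zero Z0) ?add0r //.
- by apply/vspaceP => v; rewrite (Z0 v) !mem0v.
- have -> : lker f = 0%VS by apply/eqP/lker0P; exact: can_inj fK.
  by apply/vspaceP => v; rewrite memv0; apply/memv_imgP/eqP => [[u _ ->]|->];
    [rewrite lfunE|exists 0; rewrite ?mem0v ?linear0].
- by apply/vspaceP => v; rewrite memvf -(gK v) memv_img ?memvf.
Qed.

Lemma ch_induced (N : hecke_data F) (M M' : supermod F n) :
  is_induced N M -> is_induced N M' -> ch M = ch M'.
Proof.
move=> [i [iM iU]] [i' [iM' iU']].
have [f [[fM fi] _]] := iU _ _ iM'; have [g [[gM gi] _]] := iU' _ _ iM.
have [h [_ hU]] := iU _ _ iM; have [h' [_ hU']] := iU' _ _ iM'.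
apply: (ch_iso (f := f) (g := g)) => //.
- have : (g \o f)%VF = \1%VF.
    rewrite -(hU (g \o f)%VF) ?(hU \1%VF) //.
      by split; [exact: supermorph_id|move=> v; rewrite lfunE].
    by split; [exact: supermorph_comp|move=> v; rewrite lfunE /= fi gi].
  by move=> /lfunP e v; have := e v; rewrite !lfunE.
- have : (f \o g)%VF = \1%VF.
    rewrite -(hU' (f \o g)%VF) ?(hU' \1%VF) //.
      by split; [exact: supermorph_id|move=> v; rewrite lfunE].
    by split; [exact: supermorph_comp|move=> v; rewrite lfunE /= gi fi].
  by move=> /lfunP e v; have := e v; rewrite !lfunE.
Qed.

(** [Ind] picks some supermodule with the universal property; the model shows that one exists, so
    the default branch is not taken. *)
Lemma ch_Ind (N : hecke_data F) (HN : hecke_rel n N) : ch (Ind n N) = ch (MInd HN).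
Proof.
apply: (@ch_induced N); last exact: MInd_induced.
rewrite /Ind; case: pselect => [ex|[]]; last by exists (MInd HN); exact: MInd_induced.
exact: projT2 (cid ex).
Qed.

Definition map_ind (L M : hecke_data F) (f : 'Hom(L, M)) (x : clN n L) : clN n M :=
  [ffun D => f (x D)].

Lemma map_ind_linear (L M : hecke_data F) (f : 'Hom(L, M)) : linear (map_ind f).
Proof. by move=> a u v; apply/ffunP => D; rewrite !ffunE linearP. Qed.

Section Functoriality.
Variables (L M : hecke_data F) (HL : hecke_rel n L) (HM : hecke_rel n M).
Variable f : 'Hom(L, M).
Hypothesis fM : forall i v, (0 < i < n)%N -> f (hk_pi L i v) = hk_pi M i (f v).

Definition ind_map : 'Hom(MInd HL, MInd HM) := linfun (map_ind f : MInd HL -> MInd HM).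

Lemma ind_mapE x : ind_map x = map_ind f x.
Proof. exact: linfun_linearE (@map_ind_linear _ _ _) _. Qed.

Lemma ind_map_supermorph : is_supermorph ind_map.
Proof.
split.
- apply/subvP => _ /memv_imgP [v /cl_partP ve ->]; rewrite ind_mapE; apply/cl_partP => D De.
  by rewrite ffunE ve // linear0.
- apply/subvP => _ /memv_imgP [v /cl_partP ve ->]; rewrite ind_mapE; apply/cl_partP => D De.
  by rewrite ffunE ve // linear0.
- move=> i v ir; rewrite !ind_mapE /=; apply/ffunP => D; rewrite ffunE !cl_piEf /= ![map_ind f v _]ffunE.
  by do 2 case: ifP => _; rewrite ?linearN ?linearD ?linearN /= ?fM.
- move=> j v jr; rewrite !ind_mapE /=; apply/ffunP => D.
  by rewrite cl_cEf !ffunE cl_cEf linearZ.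
Qed.

End Functoriality.

(** The induced supermodule is a sum of copies of N indexed by the sets [D], and induced maps act on
    each coordinate separately. Exactness is inherited, with preimages chosen coordinate by
    coordinate. *)
Lemma ch_Ind_ses (L M N : hecke_data F) (f : 'Hom(L, M)) (g : 'Hom(M, N)) :
  hecke_rel n L -> hecke_rel n M -> hecke_rel n N ->
  (forall i v, (0 < i < n)%N -> f (hk_pi L i v) = hk_pi M i (f v)) ->
  (forall i v, (0 < i < n)%N -> g (hk_pi M i v) = hk_pi N i (g v)) ->
  (forall v, f v = 0 -> v = 0) -> (forall v, g (f v) = 0) ->
  (forall v, g v = 0 -> exists u, v = f u) -> (forall w, exists v, w = g v) ->
  ch (Ind n M) = ch (Ind n L) + ch (Ind n N).
Proof.
move=> HL HM HN fM gM f0 gf gker gsurj; rewrite (ch_Ind HL) (ch_Ind HM) (ch_Ind HN).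
apply: (ch_add (ind_map_supermorph HL HM fM) (ind_map_supermorph HM HN gM)).
- apply/vspaceP => x; rewrite memv_ker memv0 ind_mapE; apply/eqP/eqP => [/ffunP x0|->].
    by apply/ffunP => D; have := x0 D; rewrite !ffunE => /f0.
  by apply/ffunP => D; rewrite !ffunE linear0.
- apply/vspaceP => x; rewrite memv_ker ind_mapE; apply/memv_imgP/eqP => [[u _ ->]|/ffunP x0].
    by rewrite ind_mapE; apply/ffunP => D; rewrite !ffunE gf.
  have ex D : exists u, x D = f u by apply: gker; have := x0 D; rewrite !ffunE.
  have [u xu] := choice ex.
  by exists [ffun D => u D]; rewrite ?memvf // ind_mapE; apply/ffunP => D; rewrite !ffunE.
- apply/vspaceP => x; rewrite memvf; apply/memv_imgP.
  have ex D : exists u, x D = g u by exact: gsurj.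
  have [u xu] := choice ex.
  by exists [ffun D => u D]; rewrite ?memvf // ind_mapE; apply/ffunP => D; rewrite !ffunE.
Qed.

End CharExact.

(** * Compositions and reading words *)

Section Compositions.
Implicit Types (X alpha : seq nat).

(** Consecutive differences telescope; this is why [des] recovers the set from [comp_of]. *)
Lemma sumn_take_pairmap (a : nat) (Y : seq nat) i : path leq a Y -> i <= size Y ->
  sumn (take i (pairmap (fun a b => b - a) a Y)) + a = nth 0 (a :: Y) i.
Proof.
elim: Y a i => [|y Y IH] a [|i] //= /andP [ay pY] iY.
by have := IH y i pY iY; rewrite -addnA [_ + a]addnC addnA subnK // addnC => ->.
Qed.

Lemma comp_ofE n X : sorted ltn X -> all (fun i => 0 < i < n) X ->
  comp_of n X = if n is 0 then [::] else pairmap (fun a b => b - a) 0 (rcons X n).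
Proof.
move=> sX _; case: n => //= n; rewrite sorted_sort //; first exact: leq_trans.
exact: (sub_sorted ltnW).
Qed.

Lemma path_rcons_des n X : 0 < n -> sorted ltn X -> all (fun i => 0 < i < n) X ->
  path ltn 0 (rcons X n).
Proof.
move=> n0 sX aX; rewrite rcons_path; apply/andP; split.
  by rewrite path_min_sorted //; apply: sub_all aX => i /andP [].
by case: X sX aX => [|x X] _ aX //=; have := allP aX _ (mem_last x X) => /andP [].
Qed.

Lemma sumn_comp_of n X : sorted ltn X -> all (fun i => 0 < i < n) X ->
  sumn (comp_of n X) = n.
Proof.
move=> sX aX; rewrite comp_ofE //; case: n aX => // n aX.
have p := path_rcons_des (ltn0Sn n) sX aX.
have := @sumn_take_pairmap 0 _ (size (rcons X n.+1)) (sub_path ltnW p) (leqnn _).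
by rewrite take_oversize ?size_pairmap // addn0 => ->; rewrite size_rcons /= nth_rcons ltnn eqxx.
Qed.

Lemma is_comp_comp_of n X : sorted ltn X -> all (fun i => 0 < i < n) X ->
  is_comp (comp_of n X).
Proof.
move=> sX aX; rewrite comp_ofE //; case: n aX => // n aX.
have := path_rcons_des (ltn0Sn n) sX aX.
elim: (rcons _ _) 0 => //= y Y IH a /andP [ay /IH ->].
by rewrite andbT subn_gt0.
Qed.

Lemma des_comp_of n X : sorted ltn X -> all (fun i => 0 < i < n) X ->
  des (comp_of n X) = X.
Proof.
move=> sX aX; rewrite comp_ofE //; case: n aX => [|n] aX.
  by case: X sX aX => //= x X _; rewrite ltn0 andbF.
have p := path_rcons_des (ltn0Sn n) sX aX.
rewrite /des size_pairmap size_rcons /=; apply: (@eq_from_nth _ 0).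
  by rewrite size_map size_iota.
move=> i; rewrite size_map size_iota => iX.
rewrite (nth_map 0) ?size_iota // nth_iota // add1n.
have := @sumn_take_pairmap 0 _ i.+1 (sub_path ltnW p).
by rewrite size_rcons ltnS ltnW // addn0 => -> //=; rewrite nth_rcons iX.
Qed.

Lemma foldl_addn a s : foldl addn a s = a + sumn s.
Proof. by elim: s a => [|x s IH] a /=; rewrite ?addn0 // IH addnA. Qed.

Lemma rcons_des alpha : alpha != [::] -> rcons (des alpha) (sumn alpha) = scanl addn 0 alpha.
Proof.
case: alpha => // x s _; apply: (@eq_from_nth _ 0).
  by rewrite size_rcons size_map size_iota size_scanl.
move=> i; rewrite size_rcons size_map size_iota => iX.
rewrite nth_scanl ?size_scanl // foldl_addn add0n nth_rcons size_map size_iota.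
move: iX; rewrite ltnS leq_eqVlt => /orP [/eqP ->|ix].
  by rewrite ltnn eqxx /= take_size.
rewrite ix.
by rewrite (nth_map 0) ?size_iota // nth_iota // add1n.
Qed.

Lemma path_des alpha : is_comp alpha -> alpha != [::] ->
  path ltn 0 (rcons (des alpha) (sumn alpha)).
Proof.
move=> + a0; rewrite rcons_des //; elim: alpha {a0} 0 => //= y t IH a /andP [y0 /IH ->].
by rewrite andbT -[ltnLHS]addn0 ltn_add2l.
Qed.

Lemma des_sorted alpha : is_comp alpha -> sorted ltn (des alpha).
Proof.
have [-> //|a0] := eqVneq alpha [::]; move=> /path_des /(_ a0).
by rewrite rcons_path => /andP [/path_sorted].
Qed.

Lemma des_range alpha : is_comp alpha -> all (fun i => 0 < i < sumn alpha) (des alpha).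
Proof.
have [-> //|a0] := eqVneq alpha [::]; move=> /path_des /(_ a0).
have lt := @ltn_trans; move: (des _) => X p; apply/allP => i iX.
have := p; rewrite path_sortedE // all_rcons => /andP [/andP [_ /allP/(_ _ iX) /= ->] _].
have rt : transitive (fun x y => y < x) := rev_trans lt.
have := path_sorted p; rewrite -rev_sorted rev_rcons /= path_sortedE // => /andP [/allP h _].
by apply: h; rewrite mem_rev.
Qed.

Lemma comp_of_des alpha : is_comp alpha -> comp_of (sumn alpha) (des alpha) = alpha.
Proof.
move=> ca; rewrite comp_ofE ?des_sorted ?des_range //.
case: alpha ca => // x s ca; have : 0 < sumn (x :: s) by case: x ca.
case e : (sumn (x :: s)) => // _; rewrite -e rcons_des // scanlK // => a b.
exact: addKn.
Qed.

Lemma peak_sorted X : sorted ltn X -> sorted ltn (peak X).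
Proof. exact/sorted_filter/ltn_trans. Qed.

Lemma peak_range n X : all (fun i => 0 < i < n) X -> all (fun i => 0 < i < n) (peak X).
Proof. by move=> aX; apply/allP => i; rewrite mem_filter => /andP [_ /(allP aX)]. Qed.

End Compositions.

(** * Reading words and exchange of consecutive entries *)

Section Words.
Implicit Types (S T W : seq nat) (i j n : nat).

Definition swapv i e := if e == i then i.+1 else if e == i.+1 then i else e.

Lemma swapE i T : swap i T = map (swapv i) T. Proof. by []. Qed.

Lemma swapvK i : involutive (swapv i).
Proof.
move=> e; rewrite /swapv; case: (eqVneq e i) => [->|ei].
  by rewrite eqxx eqn_leq ltnn.
case: (eqVneq e i.+1) => [->|eSi]; rewrite ?eqxx //.
by rewrite (negPf ei) (negPf eSi).
Qed.

Lemma swapK i : involutive (swap i).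
Proof. by move=> T; rewrite !swapE -map_comp map_id_in // => x _; apply: swapvK. Qed.

Lemma index_swap i e T : index e (swap i T) = index (swapv i e) T.
Proof. by rewrite -[e in LHS](swapvK i) swapE index_map //; apply: can_inj (swapvK i). Qed.

Lemma swapv_l i : swapv i i = i.+1. Proof. by rewrite /swapv eqxx. Qed.
Lemma swapv_r i : swapv i i.+1 = i. Proof. by rewrite /swapv eqxx eqn_leq ltnn. Qed.
Lemma swapv_id i e : e != i -> e != i.+1 -> swapv i e = e.
Proof. by rewrite /swapv => /negPf -> /negPf ->. Qed.

Lemma swapvE i e : swapv i e = e + (e == i) - (e == i.+1).
Proof.
rewrite /swapv; case: (eqVneq e i) => [->|_]; first by rewrite [_ == _.+1]eqn_leq ltnn andbF subn0 addn1.
by case: eqP => [->|_]; rewrite addn0 ?subn1 ?subn0.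
Qed.

Lemma swap_comm i j T : i.+1 < j -> swap i (swap j T) = swap j (swap i T).
Proof.
move=> ij; rewrite !swapE -!map_comp; apply: eq_map => e /=.
have [->|e1] := eqVneq e i; first by rewrite swapv_l !(@swapv_id j) ?swapv_l; lia.
have [->|e2] := eqVneq e i.+1; first by rewrite swapv_r !(@swapv_id j) ?swapv_r; lia.
rewrite (@swapv_id i e) //.
have [->|e3] := eqVneq e j; first by rewrite swapv_l swapv_id; lia.
have [->|e4] := eqVneq e j.+1; first by rewrite swapv_r swapv_id; lia.
by rewrite !swapv_id.
Qed.

Lemma swap_braid i T : swap i (swap i.+1 (swap i T)) = swap i.+1 (swap i (swap i.+1 T)).
Proof.
rewrite !swapE -!map_comp; apply: eq_map => e /=.
have [->|e1] := eqVneq e i.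
  by rewrite swapv_l [swapv _ i]swapv_id ?swapv_l ?swapv_id; lia.
have [->|e2] := eqVneq e i.+1.
  by rewrite swapv_r swapv_l [swapv i.+1 i]swapv_id ?swapv_l ?[swapv i i.+2]swapv_id ?swapv_r; lia.
have [->|e3] := eqVneq e i.+2.
  by rewrite [swapv i i.+2]swapv_id ?swapv_r ?[swapv i.+1 i]swapv_id; lia.
by rewrite !swapv_id.
Qed.

Lemma mem_fillings n T : (T \in fillings n) = perm_eq T (iota 1 n).
Proof. by rewrite mem_permutations. Qed.

Lemma fillings_size n T : T \in fillings n -> size T = n.
Proof. by rewrite mem_fillings => /perm_size ->; rewrite size_iota. Qed.

Lemma fillings_uniq n T : T \in fillings n -> uniq T.
Proof. by rewrite mem_fillings => /perm_uniq ->; rewrite iota_uniq. Qed.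

Lemma mem_filling n T e : T \in fillings n -> (e \in T) = (0 < e <= n).
Proof. by rewrite mem_fillings => /perm_mem ->; rewrite mem_iota add1n ltnS. Qed.

Lemma index_filling_inj n T e e' : T \in fillings n -> 0 < e <= n ->
  index e T = index e' T -> e = e'.
Proof.
move=> TF er eq_i; have eT : e \in T by rewrite (mem_filling _ TF).
by rewrite -(nth_index 0 eT) eq_i nth_index // -index_mem -eq_i index_mem.
Qed.

Lemma swap_fillings n i T : 0 < i < n -> (swap i T \in fillings n) = (T \in fillings n).
Proof.
move=> ir; suff H W : W \in fillings n -> swap i W \in fillings n.
  by apply/idP/idP => [/H|/H //]; rewrite swapK.
move=> WF; rewrite mem_fillings uniq_perm ?iota_uniq //.
  by rewrite swapE map_inj_uniq ?(fillings_uniq WF) //; apply: can_inj (swapvK i).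
move=> e; rewrite mem_iota add1n ltnS -[e](swapvK i) swapE mem_map; last first.
  exact: can_inj (swapvK i).
by rewrite (mem_filling _ WF) swapvK swapvE; lia.
Qed.

Lemma mem_desT n T i : T \in fillings n ->
  (i \in desT T) = (0 < i < n) && (index i.+1 T < index i T).
Proof.
move=> /fillings_size sT; rewrite mem_filter sT mem_iota andbC add1n.
by case: n {sT} => [|n] //=; case: i.
Qed.

Lemma desT_sorted T : sorted ltn (desT T).
Proof. by apply: sorted_filter (iota_ltn_sorted _ _); apply: ltn_trans. Qed.

Lemma desT_range n T : T \in fillings n -> all (fun i => 0 < i < n) (desT T).
Proof. by move=> TF; apply/allP => i; rewrite (mem_desT _ TF) => /andP []. Qed.

Lemma ascentE n T i : T \in fillings n -> 0 < i < n ->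
  (i \notin desT T) = (index i T < index i.+1 T).
Proof.
move=> TF ir; rewrite (mem_desT _ TF) ir /= -leqNgt leq_eqVlt; case: eqP => //= e.
by have := index_filling_inj TF _ e => /(_ (ltac:(lia))); lia.
Qed.

(* A nonattacking pi_i lowers this statistic, so that a filling for which it  *)
(* is maximal spans a simple quotient.                                        *)
Definition stat n T := \sum_(e <- iota 1 n) e * index e T.

Lemma sum_iota_split2 n i (f : nat -> nat) : 0 < i < n ->
  \sum_(e <- iota 1 n) f e =
  f i + f i.+1 + \sum_(e <- iota 1 n | (e != i.+1) && (e != i)) f e.
Proof.
move=> ir; rewrite (bigD1_seq i) ?iota_uniq ?mem_iota //=; last lia.
rewrite big_mkcond (bigD1_seq i.+1) ?iota_uniq ?mem_iota //=; last lia.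
by rewrite eqn_leq ltnn -big_mkcondr addnA.
Qed.

Lemma stat_swap n T i : T \in fillings n -> 0 < i < n -> i \notin desT T ->
  stat n (swap i T) < stat n T.
Proof.
move=> TF ir; rewrite (ascentE TF ir) => a; rewrite /stat !(sum_iota_split2 _ ir).
rewrite [X in _ + X < _](eq_bigr (fun e => e * index e T)); last first.
  by move=> e /andP [e1 e2]; rewrite index_swap swapv_id.
rewrite !index_swap swapv_l swapv_r ltn_add2r; nia.
Qed.

(** The common positions (r, s) are given as those of i and i+1 in [S] and of j and j+1 in [S']. *)
Definition asc_compat n (U : seq (seq nat)) := forall S S' i j, S \in U -> S' \in U ->
  0 < i < n -> 0 < j < n -> i \notin desT S -> j \notin desT S' ->
  index i S = index j S' -> index i.+1 S = index j.+1 S' ->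
  (swap i S \in U) = (swap j S' \in U).

End Words.

(** * Diagram modules *)

Section DiagramModules.
Variables (F : fieldType) (n : nat).
Implicit Types (U : seq (seq nat)) (S T W : seq nat).
Local Open Scope ring_scope.

Lemma simpleH_piE alpha i (v : simpleH F alpha) :
  hk_pi (simpleH F alpha) i v = if i \in des alpha then - v else 0.
Proof. by rewrite /=; case: ifP => _; rewrite !lfunE //= lfunE. Qed.

Lemma simpleH_rel alpha : hecke_rel n (simpleH F alpha).
Proof.
split=> [i v _|i j v _ _ _|i v _ _]; rewrite !simpleH_piE; case: (i \in _) => //.
- by rewrite oppr0.
- by case: (j \in _); rewrite ?oppr0.
- by case: (j \in _); rewrite ?oppr0.
- by case: (i.+1 \in _); rewrite ?oppr0.
- by case: (i.+1 \in _); rewrite ?oppr0.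
Qed.

Section Fixed.
Variable U : seq (seq nat).

(** The extension by 0 outside [U] lets vectors over different sets of fillings be compared and
    absorbs the attacking case. *)
Definition coefT (x : spanT F U) W : F := if insub W is Some V then x V else 0.

Lemma coefT_val (x : spanT F U) (S : seq_sub U) : coefT x (val S) = x S.
Proof. by rewrite /coefT valK. Qed.

Lemma coefT_notin (x : spanT F U) W : W \notin U -> coefT x W = 0.
Proof. by move=> WU; rewrite /coefT insubN. Qed.

Lemma coefT_eq (x y : spanT F U) : (forall W, W \in U -> coefT x W = coefT y W) -> x = y.
Proof. by move=> e; apply/ffunP => S; rewrite -!coefT_val e ?(valP S). Qed.

Lemma coefT_linear W : linear (fun x : spanT F U => coefT x W : F^o).
Proof.
move=> a x y; rewrite /coefT; case: insub => [S|]; first by rewrite !ffunE.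
by rewrite scaler0 addr0.
Qed.

Lemma coefT_basis S W : coefT (basisT F U S) W = ((W \in U) && (W == S))%:R.
Proof. by rewrite /coefT; case: insubP => [V -> <-|/negPf -> //]; rewrite ffunE. Qed.

Lemma diagH_piE i (x : spanT F U) :
  hk_pi (diagH F U) i x = \sum_(S : seq_sub U) x S *: pi_basisT F U i (val S).
Proof.
apply: (linfun_linearE (f := fun x : spanT F U => _)) => a u v.
rewrite scaler_sumr -big_split; apply: eq_bigr => S _.
by rewrite !ffunE scalerDl scalerA.
Qed.

Lemma basisT_sum (x : spanT F U) : x = \sum_(S : seq_sub U) x S *: basisT F U (val S).
Proof.
apply/ffunP => S; rewrite sum_ffunE (bigD1 S) //= big1 ?addr0.
  by rewrite !ffunE eqxx /GRing.scale /= mulr1.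
by move=> V VS; rewrite !ffunE /= val_eqE eq_sym (negPf VS) scaler0.
Qed.

Lemma diagH_pi_basis i S : S \in U ->
  hk_pi (diagH F U) i (basisT F U S) = pi_basisT F U i S.
Proof.
move=> SU; rewrite diagH_piE (bigD1 (SeqSub SU)) //= ffunE eqxx scale1r big1 ?addr0 //.
by move=> V VS; rewrite ffunE -val_eqE /= in VS *; rewrite (negPf VS) scale0r.
Qed.

Hypothesis UF : {subset U <= fillings n}.

Lemma swap_neq i W : W \in U -> (0 < i < n)%N -> (swap i W == W) = false.
Proof.
move=> /UF WF ir; apply/eqP => e.
have := index_swap i i W; rewrite e swapv_l => /(index_filling_inj WF); lia.
Qed.

Lemma des_swap i W : W \in U -> (0 < i < n)%N ->
  (i \in desT (swap i W)) = (i \notin desT W).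
Proof.
move=> /UF WF ir; rewrite (ascentE WF ir) (mem_desT _ (n := n)) ?swap_fillings // ir.
by rewrite !index_swap swapv_l swapv_r.
Qed.

(** The action in dual form: [W] occurs in an image under pi_i only if i is a descent of [W]. It
    then comes from [W] itself, with sign -1, and from [swap i W] if this lies in [U], i being a
    nonattacking ascent there. *)
Lemma diagH_coef i (x : spanT F U) W : (0 < i < n)%N -> W \in U ->
  coefT (hk_pi (diagH F U) i x) W =
  if i \in desT W then coefT x (swap i W) - coefT x W else 0.
Proof.
move=> ir WU; rewrite [in LHS](basisT_sum x) [in RHS](basisT_sum x).
pose cl V := coefT_linear V.
have cs V (f : seq_sub U -> spanT F U) (a : seq_sub U -> F) :
    coefT (\sum_S a S *: f S) V = \sum_S a S * coefT (f S) V.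
  elim/big_rec2: _ => [|S u v _ <-]; last exact: cl.
  by rewrite /coefT; case: insub => // S; rewrite ffunE.
rewrite linear_sum /=.
rewrite (eq_bigr (fun S : seq_sub U => x S *: pi_basisT F U i (val S))); last first.
  by move=> S _; rewrite linearZ /= diagH_pi_basis // (valP S).
rewrite !cs; case: ifP => iW.
  rewrite -sumrB; apply: eq_bigr => S _; rewrite -mulrBr; congr (_ * _).
  have SU := valP S; rewrite /pi_basisT; case: ifP => iS.
    have -> : - basisT F U (val S) = (-1) *: basisT F U (val S) + 0 by rewrite addr0 scaleN1r.
    rewrite cl -[coefT 0 W]/(coefT (0 : spanT F U) W) !coefT_basis.
    have -> : coefT (0 : spanT F U) W = 0 by rewrite /coefT; case: insub => // ?; rewrite ffunE.
    rewrite WU addr0 /GRing.scale /= mulN1r.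
    case: (eqVneq (swap i W) (val S)) => [e|_]; last by rewrite andbF sub0r.
    by have := des_swap WU ir; rewrite e iS iW.
  have e0 : (W == val S) = false by apply/eqP => e; rewrite e iS in iW.
  rewrite !coefT_basis e0 andbF subr0.
  have e : (W == swap i (val S)) = (swap i W == val S).
    by apply/eqP/eqP => [->|<-]; rewrite swapK.
  case: ifP => sU; first by rewrite coefT_basis WU e; case: eqP => [->|_]; rewrite ?SU ?andbF.
  have -> : coefT (0 : spanT F U) W = 0 by rewrite /coefT; case: insub => // ?; rewrite ffunE.
  have [eS|_] := eqVneq (swap i W) (val S); last by rewrite andbF.
  by rewrite -eS swapK WU in sU.
apply: big1 => S _; have SU := valP S.
have c0 : coefT (0 : spanT F U) W = 0 by rewrite /coefT; case: insub => // ?; rewrite ffunE.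
rewrite /pi_basisT; case: ifP => iS.
  have -> : - basisT F U (val S) = (-1) *: basisT F U (val S) + 0 by rewrite addr0 scaleN1r.
  rewrite cl c0 coefT_basis; case: eqP => [e|]; last by rewrite andbF scaler0 addr0 mulr0.
  by rewrite e iS in iW.
case: ifP => sU; last by rewrite c0 mulr0.
rewrite coefT_basis; case: eqP => [e|]; last by rewrite andbF mulr0.
by move: iW; rewrite e des_swap // iS.
Qed.

Hypothesis UC : asc_compat n U.

Let p i := hk_pi (diagH F U) i.
Let b S : diagH F U := basisT F U S.

Let pD i S : S \in U -> (0 < i < n)%N -> (index i.+1 S < index i S)%N -> p i (b S) = - b S.
Proof. by move=> SU ir d; rewrite /p diagH_pi_basis // /pi_basisT (mem_desT _ (UF SU)) ir d. Qed.

Let pA i S : S \in U -> (0 < i < n)%N -> (index i S < index i.+1 S)%N ->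
  p i (b S) = if swap i S \in U then b (swap i S) else 0.
Proof.
move=> SU ir d; rewrite /p diagH_pi_basis // /pi_basisT (mem_desT _ (UF SU)) ir /=.
by rewrite ltnNge ltnW.
Qed.

Let compat S S' i j : S \in U -> S' \in U -> (0 < i < n)%N -> (0 < j < n)%N ->
  (index i S < index i.+1 S)%N ->
  index i S = index j S' -> index i.+1 S = index j.+1 S' -> (swap i S \in U) = (swap j S' \in U).
Proof.
move=> SU SU' ir jr a e1 e2; apply: UC => //; rewrite (ascentE (UF _)) //.
by rewrite -e1 -e2.
Qed.

Let idx_neq S i j : S \in U -> (0 < i <= n)%N -> i != j -> index i S != index j S.
Proof. by move=> SU ir; apply: contraNneq => /(index_filling_inj (UF SU) ir) ->. Qed.

Lemma diagH_ind (f g : 'End(diagH F U)) : (forall S, S \in U -> f (b S) = g (b S)) -> f =1 g.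
Proof.
move=> e x; rewrite (basisT_sum x) !linear_sum; apply: eq_bigr => S _.
by rewrite !linearZ /= e // (valP S).
Qed.

Lemma diagH_rel : hecke_rel n (diagH F U).
Proof.
split.
- move=> i v ir; have := @diagH_ind (p i \o p i)%VF (- p i).
  move=> /(_ _ v); rewrite comp_lfunE opp_lfunE; apply=> S SU.
  rewrite comp_lfunE opp_lfunE; case: (ltngtP (index i S) (index i.+1 S)) => [a|d|e].
  + rewrite pA //; case: ifP => sU; last by rewrite !linear0 ?oppr0.
    by rewrite pD // !index_swap swapv_l swapv_r.
  + by rewrite pD // linearN /= pD.
  + by have := @idx_neq S i i.+1 SU; rewrite e eqxx; lia.
- move=> i j v ir jr ij; have := @diagH_ind (p i \o p j)%VF (p j \o p i)%VF.
  move=> /(_ _ v); rewrite !comp_lfunE; apply=> S SU; rewrite !comp_lfunE.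
  have x1 : index i (swap j S) = index i S by rewrite index_swap swapv_id //; lia.
  have x2 : index i.+1 (swap j S) = index i.+1 S by rewrite index_swap swapv_id //; lia.
  have x3 : index j (swap i S) = index j S by rewrite index_swap swapv_id //; lia.
  have x4 : index j.+1 (swap i S) = index j.+1 S by rewrite index_swap swapv_id //; lia.
  case: (ltngtP (index i S) (index i.+1 S)) => [ai|di|e]; last first.
  + by have := @idx_neq S i i.+1 SU; rewrite e eqxx; lia.
  + rewrite [p i (b S)]pD // linearN /=.
    case: (ltngtP (index j S) (index j.+1 S)) => [aj|dj|e]; last first.
    * by have := @idx_neq S j j.+1 SU; rewrite e eqxx; lia.
    * by rewrite pD // linearN /= pD.
    * by rewrite pA //; case: ifP => sU; rewrite ?linear0 ?oppr0 // pD // x1 x2.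
  case: (ltngtP (index j S) (index j.+1 S)) => [aj|dj|e]; last first.
  + by have := @idx_neq S j j.+1 SU; rewrite e eqxx; lia.
  + rewrite [p j (b S)]pD // linearN /=.
    by rewrite pA //; case: ifP => sU; rewrite ?linear0 ?oppr0 // pD // x3 x4.
  rewrite !pA //; case: (boolP (swap i S \in U)) => siU; case: (boolP (swap j S \in U)) => sjU.
  + by rewrite !pA ?x1 ?x2 ?x3 ?x4 // swap_comm.
  + by rewrite linear0 pA ?x3 ?x4 // -(@compat S _ j) ?(negPf sjU) ?x3 ?x4.
  + by rewrite linear0 pA ?x1 ?x2 // -(@compat S _ i) ?(negPf siU) ?x1 ?x2.
  + by rewrite !linear0.
- move=> i v i0 iN; have ir : (0 < i < n)%N by lia.
  have jr : (0 < i.+1 < n)%N by lia.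
  have := @diagH_ind (p i \o (p i.+1 \o p i))%VF (p i.+1 \o (p i \o p i.+1))%VF.
  move=> /(_ _ v); rewrite !comp_lfunE; apply=> S SU; rewrite !comp_lfunE.
  have x1 W : index i (swap i W) = index i.+1 W by rewrite index_swap swapv_l.
  have x2 W : index i.+1 (swap i W) = index i W by rewrite index_swap swapv_r.
  have x3 W : index i.+2 (swap i W) = index i.+2 W by rewrite index_swap swapv_id //; lia.
  have y1 W : index i (swap i.+1 W) = index i W by rewrite index_swap swapv_id //; lia.
  have y2 W : index i.+1 (swap i.+1 W) = index i.+2 W by rewrite index_swap swapv_l.
  have y3 W : index i.+2 (swap i.+1 W) = index i.+1 W by rewrite index_swap swapv_r.
  have n1 : index i S != index i.+1 S by apply: idx_neq => //; lia.
  have n2 : index i.+1 S != index i.+2 S by apply: idx_neq => //; lia.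
  have n3 : index i S != index i.+2 S by apply: idx_neq => //; lia.
  case: (ltngtP (index i S) (index i.+1 S)) n1 => // [ab|ba] _;
    case: (ltngtP (index i.+1 S) (index i.+2 S)) n2 => // [bc|cb] _.
  (* Let i, i+1, i+2 be at positions a < b < c. Ascent-compatibility is used once per pair of
     positions: [C1] for (a, b), [C2] for (a, c), [C3] for (b, c). Then both triple products reach
     the same filling or both vanish. *)
  + have ac := ltn_trans ab bc; rewrite !pA //.
    have C1 : swap i (swap i.+1 S) \in U ->
        (swap i S \in U) = (swap i.+1 (swap i (swap i.+1 S)) \in U).
      by move=> WU; apply: compat; rewrite ?x2 ?x3 ?y1 ?y3.
    have C2 : swap i S \in U -> swap i.+1 S \in U ->
        (swap i.+1 (swap i S) \in U) = (swap i (swap i.+1 S) \in U).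
      by move=> W1 W2; apply: compat; rewrite ?x2 ?x3 ?y1 ?y2.
    have C3 : swap i.+1 (swap i S) \in U ->
        (swap i.+1 S \in U) = (swap i (swap i.+1 (swap i S)) \in U).
      by move=> WU; apply: compat; rewrite ?y1 ?y2 ?x1 ?x3.
    case: (boolP (swap i S \in U)) => sU; case: (boolP (swap i.+1 S \in U)) => tU.
    * rewrite (pA sU) ?x2 ?x3 // (pA tU) ?y1 ?y2 // C2 //.
      case: (boolP (swap i (swap i.+1 S) \in U)) => stU; last by rewrite !linear0.
      have tsU : swap i.+1 (swap i S) \in U by rewrite C2.
      rewrite (pA tsU) ?y1 ?y2 ?x1 ?x3 // (pA stU) ?x2 ?x3 ?y1 ?y3 //.
      by rewrite -C1 // -C3 // sU tU swap_braid.
    * rewrite !linear0 (pA sU) ?x2 ?x3 //; case: ifP => [tsU|_]; last by rewrite linear0.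
      by rewrite (pA tsU) ?y1 ?y2 ?x1 ?x3 // -C3 // (negPf tU).
    * rewrite !linear0 (pA tU) ?y1 ?y2 //; case: ifP => [stU|_]; last by rewrite linear0.
      by rewrite (pA stU) ?x2 ?x3 ?y1 ?y3 // -C1 // (negPf sU).
    * by rewrite !linear0.
  + rewrite [p i.+1 (b S)]pD // (pA SU) // !linearN /= (pA SU) //.
    case: ifP => [sU|_]; last by rewrite !linear0 ?oppr0.
    case: (ltngtP (index i S) (index i.+2 S)) n3 => // [ac|ca] _.
      rewrite (pA sU) ?x2 ?x3 //; case: ifP => [tsU|_]; last by rewrite !linear0 ?oppr0.
      by rewrite pD // y1 y2 x1 x3.
    by rewrite (pD sU) ?x2 ?x3 // linearN /= pD // x1 x2.
  + rewrite [p i (b S)]pD // (pA SU) // !linearN /= (pA SU) //.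
    case: ifP => [tU|_]; last by rewrite !linear0 ?oppr0.
    case: (ltngtP (index i S) (index i.+2 S)) n3 => // [ac|ca] _.
      rewrite (pA tU) ?y1 ?y2 //; case: ifP => [stU|_]; last by rewrite !linear0 ?oppr0.
      by rewrite pD // x2 x3 y1 y3.
    by rewrite (pD tU) ?y1 ?y2 // [in RHS]linearN /= pD // y2 y3.
  + by rewrite !pD // !linearN /= !pD // !linearN /= !pD.
Qed.
End Fixed.

(** No nonattacking step from [U'] ends in [T], so [U'] spans a submodule, included by extending
    coefficients by 0 ([f0]). The coefficient of [T] is the quotient map, and on the quotient pi_i
    acts by -1 or 0 according to Des(T). *)
Lemma diagH_ses (ch : supermod F n -> series F) U U' T :
  additive_on_ses ch -> {subset U <= fillings n} -> asc_compat n U -> asc_compat n U' ->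
  T \notin U' -> (forall S, (S \in U) = (S == T) || (S \in U')) ->
  (forall i S, (0 < i < n)%N -> S \in U' -> i \notin desT S -> swap i S != T) ->
  ch (Ind n (diagH F U)) =
  ch (Ind n (diagH F U')) + ch (Ind n (simpleH F (comp_of n (desT T)))).
Proof.
move=> chA UF UC UC' TU' UE cl.
have TU : T \in U by rewrite UE eqxx.
have U'U S : S \in U' -> S \in U by rewrite UE orbC => ->.
have U'F : {subset U' <= fillings n} by move=> S /U'U /UF.
have TF := UF _ TU.
have desE : des (comp_of n (desT T)) = desT T.
  by rewrite des_comp_of ?desT_sorted // (desT_range TF).
pose f0 (x : diagH F U') : diagH F U := [ffun S : seq_sub U => coefT x (val S)].
have f0lin : linear f0.
  by move=> a u v; apply/ffunP => S; rewrite !ffunE; exact: (coefT_linear (val S)).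
have f0E W x : coefT (f0 x) W = coefT x W.
  case: (boolP (W \in U)) => WU.
    by rewrite -[W]/(val (SeqSub WU)) coefT_val ffunE.
  by rewrite !coefT_notin //; apply: contra WU => /U'U.
have sTU' i : (0 < i < n)%N -> i \in desT T -> swap i T \notin U'.
  move=> ir iT; apply/negP => sU; have := cl i _ ir sU.
  by rewrite (des_swap UF) // iT swapK eqxx => /(_ isT).
pose f : 'Hom(diagH F U', diagH F U) := linfun f0.
have fE x : f x = f0 x by exact: linfun_linearE.
pose g : 'Hom(diagH F U, simpleH F (comp_of n (desT T))) :=
  linfun (fun x : diagH F U => coefT x T : simpleH F (comp_of n (desT T))).
have gE x : g x = coefT x T by exact: (linfun_linearE (@coefT_linear _ T)).
apply: (ch_Ind_ses chA (f := f) (g := g)).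
- exact: diagH_rel.
- exact: diagH_rel.
- exact: simpleH_rel.
- move=> i v ir; rewrite !fE; apply: coefT_eq => W WU; rewrite f0E [in RHS]diagH_coef // !f0E.
  case: (boolP (W \in U')) => [WU'|WU']; first by rewrite diagH_coef.
  have WT : W = T by move: WU; rewrite UE (negPf WU') orbF => /eqP.
  rewrite coefT_notin //; case: ifP => // iT; rewrite WT in iT *.
  by rewrite !coefT_notin ?subr0 // sTU'.
- move=> i v ir; rewrite !gE diagH_coef // simpleH_piE desE; case: ifP => // iT.
  rewrite (coefT_notin v (W := swap i T)) ?sub0r //.
  rewrite UE negb_or sTU' // andbT; apply/negP => /eqP e.
  by have := swap_neq UF TU ir; rewrite e eqxx.
- move=> v; rewrite fE => v0; apply: coefT_eq => W _; rewrite -f0E v0.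
  by rewrite /coefT; do 2 case: insub => [?|]; rewrite ?ffunE.
- by move=> v; rewrite gE fE f0E coefT_notin.
- move=> v; rewrite gE => vT; exists [ffun S : seq_sub U' => coefT v (val S)].
  rewrite fE; apply: coefT_eq => W WU; rewrite f0E.
  case: (boolP (W \in U')) => WU'.
    by rewrite -[W in RHS]/(val (SeqSub WU')) coefT_val ffunE.
  move: WU; rewrite UE (negPf WU') orbF => /eqP ->.
  by rewrite [RHS]coefT_notin.
- move=> w; exists ((w : F) *: basisT F U T); rewrite gE.
  have := coefT_linear T (w : F) (basisT F U T) 0; rewrite addr0 => ->.
  rewrite coefT_basis TU eqxx /= /coefT; case: insub => [V|]; rewrite ?ffunE addr0 /GRing.scale /= ?mulr1 //.
Qed.

(** Induction on the number of fillings. One that maximises [stat] is not the outcome of a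
    nonattacking step, since such steps lower [stat], so it can be split off. The others stay
    ascent-compatible, as no step from them led to the removed one. *)
Lemma ch_diagH (ch : forall n, supermod F n -> series F) U : is_peak_char ch ->
  uniq U -> {subset U <= fillings n} -> asc_compat n U ->
  ch n (Ind n (diagH F U)) = \sum_(T <- U) peakK F (comp_of n (peak (desT T))).
Proof.
move=> [_ chA chM]; have [m] := ubnP (size U); elim: m U => // m IH [|T0 U0] Um Uu UF UC.
  rewrite big_nil (ch_Ind (chA n) (diagH_rel UF UC)); apply: (ch_zero (chA n)) => v.
  by apply/ffunP => D; apply/ffunP => -[].
set U := T0 :: U0 in Um Uu UF UC *.
have [T TU Tmax] : exists2 T, T \in U & forall S, S \in U -> (stat n S <= stat n T)%N.
  have T0U : T0 \in U by rewrite mem_head.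
  case: (arg_maxnP (P := predT) (fun S : seq_sub U => stat n (val S)) (i0 := SeqSub T0U) isT).
  by move=> T _ Tm; exists (val T); [exact: valP|move=> S SU; apply: (Tm (SeqSub SU))].
pose U' := rem T U.
have U'E S : (S \in U') = (S != T) && (S \in U) by rewrite mem_rem_uniq.
have TU' : T \notin U' by rewrite U'E eqxx.
have UE S : (S \in U) = (S == T) || (S \in U') by rewrite U'E; case: eqP => // ->.
have U'F : {subset U' <= fillings n} by move=> S; rewrite U'E => /andP [_ /UF].
have cl i S : (0 < i < n)%N -> S \in U' -> i \notin desT S -> swap i S != T.
  move=> ir SU' iS; have SU : S \in U by move: SU'; rewrite U'E => /andP [].
  apply/eqP => e; have := stat_swap (UF _ SU) ir iS; rewrite e ltnNge.
  by rewrite Tmax.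
have UC' : asc_compat n U'.
  move=> S S' i j SU SU' ir jr iS jS e1 e2; rewrite !U'E !cl //=.
  by apply: UC => //; move: SU SU'; rewrite !U'E => /andP [_ ?] /andP [_ ?].
rewrite (diagH_ses (chA n) UF UC UC' TU' UE cl) (IH U') ?rem_uniq //; last first.
  by rewrite size_rem // -ltnS.
have TF := UF _ TU.
have rX := desT_range TF; have sX := desT_sorted T.
have := chM _ (is_comp_comp_of sX rX); rewrite /Mind des_comp_of //.
have -> : sumn (comp_of n (desT T)) = n by rewrite sumn_comp_of.
by move=> ->; rewrite (perm_big _ (perm_to_rem TU)) big_cons addrC.
Qed.

End DiagramModules.

(** * Peak Young composition tableaux *)

Lemma pairwise_allpairs_dep (A B C : eqType) (R : rel C) (P : rel A) (f : A -> B -> C) s t :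
  pairwise P s ->
  (forall x x' y y', x \in s -> P x x' -> R (f x y) (f x' y')) ->
  (forall x, x \in s -> pairwise (fun y y' => R (f x y) (f x y')) (t x)) ->
  pairwise R [seq f x y | x <- s, y <- t x].
Proof.
elim: s => //= x s IH /andP [xs ps] R1 R2; rewrite pairwise_cat; apply/and3P; split.
- apply/allrelP => _ _ /mapP [y _ ->] /allpairsPdep [x' [y' [x's _ ->]]].
  by apply: R1; [exact: mem_head|exact: (allP xs)].
- by rewrite pairwise_map; apply: R2; exact: mem_head.
- by apply: IH => // [x1 x2 y1 y2 xs1|x1 xs1]; [apply: R1|apply: R2]; rewrite inE xs1 orbT.
Qed.

(** Turns comparisons of indices in a reading order into comparisons of coordinates. *)
Lemma index_sorted_rel (A : eqType) (R : rel A) s : irreflexive R -> transitive R ->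
  sorted R s -> {in s &, forall x y, (index x s < index y s) = R x y}.
Proof.
move=> Ri Rt Rs x y xs ys; have H := @sorted_ltn_index _ _ Rt _ Rs.
apply/idP/idP => [/(H _ _ xs ys) //|l].
case: ltngtP => // [/(H _ _ ys xs) l'|e]; first by rewrite -(Ri x) (Rt _ _ _ l l').
by rewrite -(nth_index x xs) e nth_index // Ri in l.
Qed.

Section Diagrams.
Implicit Types (alpha beta : seq nat) (b : box).

Lemma nth_leq_sumn alpha i : nth 0 alpha i <= sumn alpha.
Proof.
elim: alpha i => [|x s IH] [|i] //=; first exact: leq_addr.
exact: leq_trans (IH i) (leq_addl _ _).
Qed.

Lemma mem_diag alpha b : (b \in diag alpha) = in_diag alpha b.
Proof.
rewrite mem_filter andb_idr // /in_diag => /andP [/andP [r0 rs] /andP [c0 cs]].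
have cS := leq_trans cs (nth_leq_sumn _ _); rewrite mem_cat; apply/orP.
case: b r0 rs c0 cs cS => [[|[|c]] r] //= r0 rs _ _ cS; [left|right].
  by rewrite map_f // mem_rev mem_iota add1n ltnS r0.
by apply/allpairsP; exists (c.+2, r); split=> //; rewrite mem_iota /=; lia.
Qed.

Definition readlt : rel box := fun b b' => (b.1 < b'.1) ||
  ((b.1 == b'.1) && (if b.1 == 1 then b'.2 < b.2 else b.2 < b'.2)).

Lemma readlt_irr : irreflexive readlt.
Proof. by move=> b; rewrite /readlt !ltnn if_same andbF. Qed.

Lemma readlt_trans : transitive readlt.
Proof.
move=> [c2 r2] [c1 r1] [c3 r3]; rewrite /readlt /=.
case: (ltngtP c1 c2) => [l12|//|e12] /=; case: (ltngtP c2 c3) => [l23|//|e23] //=.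
- by rewrite (ltn_trans l12).
- by rewrite -e23 l12.
- by rewrite e12 l23.
- rewrite -e23 e12 eqxx ltnn /=; case: ifP => _ h1 h2; last exact: ltn_trans h1 h2.
  exact: ltn_trans h2 h1.
Qed.

Lemma diag_sorted alpha : sorted readlt (diag alpha).
Proof.
apply: sorted_filter; first exact: readlt_trans.
rewrite (sorted_pairwise readlt_trans) pairwise_cat; apply/and3P; split.
- apply/allrelP => _ _ /mapP [r _ ->] /allpairsP [[c' r'] [/= c's _ ->]].
  by rewrite /readlt /=; move: c's; rewrite mem_iota; case/andP => ->.
- rewrite pairwise_map -(sorted_pairwise (leT := fun r r' => readlt (1, r) (1, r'))).
    rewrite rev_sorted; apply: sub_sorted (iota_ltn_sorted _ _) => r r' /=.
    by rewrite /readlt /= => ->.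
  by move=> r2 r1 r3; apply: readlt_trans.
- have i_pw m k : pairwise ltn (iota m k) by rewrite -(sorted_pairwise ltn_trans) iota_ltn_sorted.
  apply: (pairwise_allpairs_dep (P := ltn)) => // [c c' r r' _ cc'|c]; first by rewrite /readlt /= (cc' : c < c').
  rewrite mem_iota => /andP [c2 _]; apply: sub_pairwise (i_pw _ _) => r r' rr'.
  by rewrite /readlt /= eqxx (gtn_eqF c2) (rr' : r < r') orbT.
Qed.

Lemma diag_uniq alpha : uniq (diag alpha).
Proof. exact: sorted_uniq readlt_trans readlt_irr _ (diag_sorted alpha). Qed.

Lemma index_diag alpha b b' : b \in diag alpha -> b' \in diag alpha ->
  (index b (diag alpha) < index b' (diag alpha)) = readlt b b'.
Proof. exact: index_sorted_rel readlt_irr readlt_trans (diag_sorted alpha) b b'. Qed.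

Lemma size_diag alpha : size (diag alpha) = sumn alpha.
Proof.
pose rows := [seq (c, r) | r <- iota 1 (size alpha), c <- iota 1 (nth 0 alpha r.-1)].
have u : uniq rows.
  apply: allpairs_uniq_dep => [|r _|[r c] [r' c'] _ _ /= [-> ->] //]; exact: iota_uniq.
have e : diag alpha =i rows.
  move=> [c r]; rewrite mem_diag /in_diag /=.
  apply/andP/allpairsPdep => [[r1 c1]|[r' [c' [+ + [-> ->]]]]].
    by exists r, c; rewrite !mem_iota !add1n !ltnS r1 c1.
  by rewrite !mem_iota !add1n !ltnS => -> ->.
rewrite (perm_size (uniq_perm (diag_uniq alpha) u e)) size_allpairs_dep.
rewrite (eq_map (g := fun r => nth 0 alpha r.-1)); last by move=> r; rewrite size_iota.
rewrite -[1]addn0 iotaDl -map_comp (eq_map (g := nth 0 alpha)) //.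
by rewrite -/(mkseq _ _) mkseq_nth.
Qed.

End Diagrams.

(** * The dictionary between boxes and entries *)

Section Entries.
Variables (D : seq box) (n : nat) (T : seq nat).
Hypotheses (Du : uniq D) (Dn : size D = n) (TF : T \in fillings n).

(** The inverse of [entry]; the default [(0, 0)] is not met for 0 < e <= n. *)
Definition box_of e : box := nth (0, 0) D (index e T).

Lemma mem_box_of e : 0 < e <= n -> box_of e \in D.
Proof. by move=> er; rewrite mem_nth // Dn -(fillings_size TF) index_mem (mem_filling _ TF). Qed.

Lemma box_ofK e : 0 < e <= n -> entry D T (box_of e) = e.
Proof.
move=> er; have eT : e \in T by rewrite (mem_filling _ TF).
by rewrite /entry /box_of index_uniq ?nth_index // Dn -(fillings_size TF) index_mem.
Qed.

Lemma index_lt_size b : b \in D -> index b D < size T.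
Proof. by rewrite (fillings_size TF) -Dn index_mem. Qed.

Lemma entry_range b : b \in D -> 0 < entry D T b <= n.
Proof. by move=> bD; rewrite -(mem_filling _ TF) mem_nth // index_lt_size. Qed.

Lemma index_entry b : b \in D -> index (entry D T b) T = index b D.
Proof. by move=> bD; rewrite index_uniq ?(fillings_uniq TF) // index_lt_size. Qed.

Lemma entryK b : b \in D -> box_of (entry D T b) = b.
Proof. by move=> bD; rewrite /box_of index_entry // nth_index. Qed.

Lemma entry_inj b b' : b \in D -> b' \in D -> entry D T b = entry D T b' -> b = b'.
Proof. by move=> bD b'D e; rewrite -(entryK bD) e entryK. Qed.

Lemma map_entry : [seq entry D T b | b <- D] = T.
Proof.
apply: (@eq_from_nth _ 0); rewrite size_map Dn -?(fillings_size TF) // => i iT.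
by rewrite (nth_map (0, 0)) ?Dn -?(fillings_size TF) // /entry index_uniq // Dn -(fillings_size TF).
Qed.

Lemma entry_swap i b : b \in D -> entry D (swap i T) b = swapv i (entry D T b).
Proof. by move=> bD; rewrite /entry swapE (nth_map 0) // index_lt_size. Qed.

Lemma mem_desT_index i : 0 < i < n ->
  (i \in desT T) = (index (box_of i.+1) D < index (box_of i) D).
Proof.
move=> ir; rewrite (mem_desT _ TF) ir -[in LHS](@box_ofK i.+1) -1?[in index i T](@box_ofK i); try lia.
by rewrite !index_entry // mem_box_of //; lia.
Qed.

End Entries.

(** A down-closed property holds on an initial segment, whose length is the number of its members.
    Used for the rows, and the boxes of a row, that carry entries at most k. *)
Lemma down_count (a : pred nat) N : (forall c c', 0 < c -> c <= c' <= N -> a c' -> a c) ->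
  forall c, 0 < c <= N -> a c = (c <= count a (iota 1 N)).
Proof.
elim: N => [|N IH] H c; first by case: c.
have H' c0 c' : 0 < c0 -> c0 <= c' <= N -> a c' -> a c0.
  by move=> ? /andP [? ?]; apply: H => //; apply/andP; split=> //; apply: leqW.
have -> : iota 1 N.+1 = iota 1 N ++ [:: N.+1] by rewrite -{1}[N.+1]addn1 iotaD.
rewrite count_cat /= addn0 => /andP [c0].
have cle : count a (iota 1 N) <= N by rewrite -[leqRHS](size_iota 1) count_size.
case: (boolP (a N.+1)) => aN.
  have -> : count a (iota 1 N) = N.
    rewrite -[RHS](size_iota 1 N); apply/eqP; rewrite -all_count; apply/allP => i.
    rewrite mem_iota add1n ltnS => /andP [i0 iN]; apply: H aN => //.
    by rewrite leqW /=.
  by move=> cN; rewrite addn1 cN (H c N.+1) ?cN /=.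
rewrite addn0 leq_eqVlt => /orP [/eqP ->|cN].
  by rewrite (negPf aN) leqNgt ltnS cle.
by apply: IH => //; rewrite c0.
Qed.

(** * The rules for peak Young composition tableaux *)

Section Tableaux.
Variable alpha : seq nat.
Local Notation D := (diag alpha).
Local Notation n := (sumn alpha).
Implicit Type T : seq nat.

Definition row_incr T := forall c c' r, (c, r) \in D -> (c', r) \in D -> c < c' ->
  entry D T (c, r) < entry D T (c', r).
Definition col1_incr T := forall r r', (1, r) \in D -> (1, r') \in D -> r < r' ->
  entry D T (1, r) < entry D T (1, r').
Definition triple_rule T := forall c r r', (c, r) \in D -> (c.+1, r') \in D -> r' < r ->
  entry D T (c, r) < entry D T (c.+1, r') ->
  (c.+1, r) \in D /\ entry D T (c.+1, r) < entry D T (c.+1, r').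
(* For a tableau satisfying (SYCT1) and (SYCT2), this says that the boxes     *)
(* with entries at most k always form the diagram of a peak composition.      *)
Definition peak_rule T := forall r, 0 < r -> (1, r.+1) \in D ->
  (2, r) \in D /\ entry D T (2, r) < entry D T (1, r.+1).

Lemma SYCTP T : reflect [/\ T \in fillings n, row_incr T, col1_incr T & triple_rule T]
  (T \in SYCT alpha).
Proof.
rewrite mem_filter; apply: (iffP andP) => [[/and3P [h1 h2 h3] TF]|[TF h1 h2 h3]]; split=> //.
- move=> c c' r bD b'D cc'; have := allP (allP h1 _ bD) _ b'D.
  by rewrite /= eqxx cc'.
- move=> r r' bD b'D rr'; have := allP (allP h2 _ bD) _ b'D.
  by rewrite /= rr'.
- move=> c r r' bD b'D rr' lt; have := allP (allP h3 _ bD) _ b'D.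
  by rewrite /= eqxx rr' lt => /andP.
- apply/and3P; split; apply/allP => -[c r] bD; apply/allP => -[c' r'] b'D; apply/implyP => /=.
  + by move=> /andP [/eqP e cc']; rewrite -e in b'D *; apply: h1.
  + by move=> /and3P [/eqP e /eqP e' rr']; rewrite e e' in bD b'D *; apply: h2.
  + move=> /and3P [/eqP e rr' lt]; rewrite e in b'D lt *.
    by have [-> ->] := h3 _ _ _ bD b'D rr' lt.
Qed.

Lemma diag_down c c' r : (c', r) \in D -> 0 < c <= c' -> (c, r) \in D.
Proof. by rewrite !mem_diag /in_diag /= => /andP [-> /andP [_ h]] /andP [-> /leq_trans ->]. Qed.

Lemma diag_range c r : (c, r) \in D -> [/\ 0 < c, 0 < r, r <= size alpha & c <= nth 0 alpha r.-1].
Proof. by rewrite mem_diag /in_diag /= => /andP [/andP [-> ->] /andP [-> ->]]. Qed.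

Lemma nth_peak_comp beta r : is_peak_comp beta -> 0 < r < size beta -> 1 < nth 0 beta r.-1.
Proof.
move=> /andP [_ /all_nthP h] /andP [r0 rs]; have := h 0 r.-1.
rewrite size_takel ?leq_pred // nth_take; last by lia.
by apply; lia.
Qed.

Hypothesis alpha_comp : is_comp alpha.

Lemma diag_col1 r : ((1, r) \in D) = (0 < r <= size alpha).
Proof.
rewrite mem_diag /in_diag /=; case: (boolP (0 < r <= size alpha)) => //= /andP [r0 rs].
by apply: (all_nthP 0 alpha_comp); rewrite prednK.
Qed.

Definition restrict_rows T k :=
  [seq count (fun c => entry D T (c, r) <= k) (iota 1 (nth 0 alpha r.-1))
     | r <- iota 1 (count (fun r => entry D T (1, r) <= k) (iota 1 (size alpha)))].

(** For k = T(1, r+1) the boxes with entries at most k reach row r+1, so row r is not their last row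
    and holds at least two of them: this gives the peak rule. Conversely, these boxes form initial
    segments of the rows and of the first column, and the peak rule puts two of them in each row but
    the last. *)
Lemma SPYCTP T : reflect (T \in SYCT alpha /\ peak_rule T) (T \in SPYCT alpha).
Proof.
rewrite [T \in SPYCT _]mem_filter; apply: (iffP andP) => [[h ST]|[ST P4]]; split=> //.
  move=> r r0 bD; case/SYCTP: (ST) => TF _ _ _.
  have kr := entry_range (size_diag alpha) TF bD; set k := entry _ _ _ in kr.
  have /hasP [beta _ /andP [pb /perm_mem Db]] := allP h k ltac:(by rewrite mem_iota add1n ltnS).
  have : (1, r.+1) \in diag beta by rewrite Db mem_filter bD leqnn.
  rewrite mem_diag /in_diag /= => /andP [rb _].
  have : (2, r) \in diag beta.
    by rewrite mem_diag /in_diag /= r0 (ltnW rb) nth_peak_comp ?r0.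
  rewrite Db mem_filter => /andP [lk b2]; split=> //.
  rewrite ltn_neqAle lk andbT; apply/eqP => /(entry_inj (size_diag _) TF b2 bD).
  by [].
case/SYCTP: (ST) => TF P1 P2 _.
apply/allP => k; rewrite mem_iota add1n ltnS => /andP [k0 kn].
set m := count (fun r => entry D T (1, r) <= k) (iota 1 (size alpha)).
have ms : m <= size alpha by rewrite -[leqRHS](size_iota 1) count_size.
have rowk r : 0 < r <= size alpha -> (entry D T (1, r) <= k) = (r <= m).
  apply: (@down_count (fun r => entry D T (1, r) <= k)) => r1 r2 r10 /andP [].
  rewrite leq_eqVlt => /orP [/eqP -> //|l12] l2 h; apply: leq_trans h; apply: ltnW.
  by apply: P2; rewrite ?diag_col1 //; lia.
have colk r c : 0 < r <= size alpha -> 0 < c <= nth 0 alpha r.-1 ->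
    (entry D T (c, r) <= k) = (c <= count (fun c => entry D T (c, r) <= k) (iota 1 (nth 0 alpha r.-1))).
  move=> rs; apply: (@down_count (fun c => entry D T (c, r) <= k)) => c1 c2 c10 /andP [].
  rewrite leq_eqVlt => /orP [/eqP -> //|l12] l2 h; apply: leq_trans h; apply: ltnW.
  by apply: P1; rewrite ?mem_diag /in_diag /= ?rs //=; lia.
pose beta := restrict_rows T k.
have nb r : 0 < r <= m -> nth 0 beta r.-1 = count (fun c => entry D T (c, r) <= k) (iota 1 (nth 0 alpha r.-1)).
  move=> rm; rewrite (nth_map 0) ?size_iota -/m; last by lia.
  by rewrite nth_iota ?add1n ?prednK //; lia.
have sb : size beta = m by rewrite size_map size_iota.
have Db : diag beta =i [seq b <- D | entry D T b <= k].
  move=> [c r]; rewrite [RHS]mem_filter !mem_diag /in_diag /= sb.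
  apply/andP/andP => [[r1 c1]|[ek /andP [r1 c1]]].
    have ra : 0 < r <= size alpha by lia.
    have c2 : 0 < c <= nth 0 alpha r.-1.
      case/andP: c1 => -> /leq_trans; apply; rewrite nb //.
      by rewrite -[leqRHS](size_iota 1) count_size.
    by rewrite ra c2 colk // -nb //; case/andP: c1.
  have rm : r <= m.
    rewrite -rowk //; apply: leq_trans ek; have [->//|c_1] := eqVneq c 1.
    by apply: ltnW; apply: P1; rewrite ?mem_diag /in_diag /= ?r1 //=; lia.
  have rm' : 0 < r <= m by lia.
  by rewrite nb // -colk // ek rm' (andP c1).1.
have pDb : perm_eq (diag beta) [seq b <- D | entry D T b <= k].
  by apply: uniq_perm Db; [exact: diag_uniq|exact/filter_uniq/diag_uniq].
have cb : is_comp beta.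
  apply/(all_nthP 0) => i; rewrite sb => im; rewrite -[ i ]/(i.+1.-1) nb ?im //.
  have ia : 0 < i.+1 <= size alpha by lia.
  by rewrite -colk ?rowk // andTb; apply: (all_nthP 0 alpha_comp); lia.
apply/hasP; exists beta; last first.
  rewrite pDb andbT /is_peak_comp cb /=; apply/(all_nthP 0) => i.
  rewrite sb size_takel ?sb ?leq_pred // => im; rewrite nth_take //.
  rewrite -[ i ]/(i.+1.-1) nb; last by lia.
  have [] := P4 i.+1; rewrite ?diag_col1 //; first by lia.
  move=> b2 l2; have [_ _ r2 c2] := diag_range b2.
  rewrite -colk //; apply: leq_trans (ltnW l2) _; rewrite rowk //; lia.
rewrite mem_compositions cb /= -size_diag (perm_size pDb) size_filter.
have -> : count (fun b => entry D T b <= k) D = count (leq^~ k) T.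
  by rewrite -{2}(map_entry (diag_uniq alpha) (size_diag alpha) TF) count_map.
move: TF; rewrite mem_fillings => /permP ->.
rewrite -(subnKC kn) iotaD count_cat; apply/eqP.
have -> : count (leq^~ k) (iota 1 k) = k.
  by rewrite -[RHS](size_iota 1 k); apply/eqP; rewrite -all_count; apply/allP => x; rewrite mem_iota /=; lia.
rewrite (_ : count _ _ = 0) ?addn0 //; apply/eqP; rewrite -leqn0 leqNgt -has_count.
by apply/hasPn => x; rewrite mem_iota /=; lia.
Qed.

End Tableaux.

(** * Ascent-compatibility and dominance of peak sets *)

Lemma ltn_swapv i m1 m2 : m1 < m2 -> (m1 == i) && (m2 == i.+1) = false ->
  swapv i m1 < swapv i m2.
Proof. by rewrite /swapv; do ! case: eqP => //=; lia. Qed.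

Lemma swapv_ltn i m1 m2 : swapv i m1 < swapv i m2 -> m2 < m1 -> m2 = i /\ m1 = i.+1.
Proof. by rewrite /swapv; do ! case: eqP => //=; lia. Qed.

Section AscentCompatible.
Variable alpha : seq nat.
Hypothesis alpha_comp : is_comp alpha.
Local Notation D := (diag alpha).
Local Notation n := (sumn alpha).
Let Du : uniq D := diag_uniq alpha.
Let Dn : size D = n := size_diag alpha.

Lemma ascent_readlt T i x y : T \in fillings n -> 0 < i < n -> i \notin desT T ->
  x \in D -> y \in D -> entry D T x = i -> entry D T y = i.+1 -> readlt x y.
Proof.
move=> TF ir; rewrite (ascentE TF ir) => a xD yD ex ey.
by rewrite -(index_diag xD yD) -!(index_entry Dn TF) // ex ey.
Qed.

Lemma descent_readlt T i x y : T \in fillings n -> i \in desT T ->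
  x \in D -> y \in D -> entry D T x = i -> entry D T y = i.+1 -> readlt y x.
Proof.
move=> TF; rewrite (mem_desT _ TF) => /andP [ir a] xD yD ex ey.
by rewrite -(index_diag yD xD) -!(index_entry Dn TF) // ex ey.
Qed.

Definition row_adjacent (x y : box) := (x.2 == y.2) && (y.1 == x.1.+1).

(** The exchange affects only the comparison of the boxes of i and i+1. Boxes of one row that are
    not adjacent have an entry strictly between theirs, and a clash with the first column, the
    triple rule or the peak rule would make i a descent. The resulting criterion depends on
    positions alone, whence ascent-compatibility. *)
Lemma swap_SPYCT T i : T \in SPYCT alpha -> 0 < i < n -> i \notin desT T ->
  (swap i T \in SPYCT alpha) = ~~ row_adjacent (box_of D T i) (box_of D T i.+1).
Proof.
move=> /(SPYCTP alpha_comp) [/SYCTP [TF P1 P2 P3] P4] ir iT.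
have bi : 0 < i <= n by lia.
have bSi : 0 < i.+1 <= n by lia.
have xD := mem_box_of Dn TF bi; have yD := mem_box_of Dn TF bSi.
have ex := box_ofK Du Dn TF bi; have ey := box_ofK Du Dn TF bSi.
have es := entry_swap Dn TF i.
apply/(SPYCTP alpha_comp)/idP => [[/SYCTP [_ Q1 _ _] _]|adj].
  apply/negP; move: xD yD ex ey; case: (box_of D T i) => c r; case: (box_of D T i.+1) => c' r'.
  move=> xD yD ex ey; rewrite /row_adjacent /= => /andP [/eqP e1 /eqP e2].
  rewrite -e1 e2 in yD ey; have := Q1 _ _ _ xD yD (ltnSn _).
  by rewrite !es // ex ey swapv_l swapv_r ltnNge leqnSn.
have lt_es x y : x \in D -> y \in D -> entry D T x < entry D T y ->
    (entry D T x = i -> entry D T y = i.+1 -> False) ->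
    entry D (swap i T) x < entry D (swap i T) y.
  move=> xD' yD' lt nxy; rewrite !es //; apply: ltn_swapv lt _; apply/negP => /andP [/eqP + /eqP].
  exact: nxy.
have asc x y := @ascent_readlt T i x y TF ir iT.
split; first (apply/SYCTP; split; first by rewrite swap_fillings).
- move=> c c' r cD c'D cc'; apply: lt_es (P1 _ _ _ cD c'D cc') _ => // e1 e2.
  have e1' : box_of D T i = (c, r) by rewrite -e1 (entryK Dn TF).
  have e2' : box_of D T i.+1 = (c', r) by rewrite -e2 (entryK Dn TF).
  move: adj; rewrite e1' e2' /row_adjacent /= eqxx /= => cc.
  have c1D : (c.+1, r) \in D by apply: diag_down c'D _; lia.
  have l1 := P1 _ _ _ cD c1D (ltnSn _).
  have cc2 : c.+1 < c' by rewrite ltn_neqAle eq_sym cc.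
  by have := P1 _ _ _ c1D c'D cc2; rewrite e1 e2 in l1 *; lia.
- move=> r r' rD r'D rr'; apply: lt_es (P2 _ _ rD r'D rr') _ => // e1 e2.
  have := asc _ _ rD r'D e1 e2; rewrite /readlt /=; lia.
- move=> c r r' xD' yD' rr' lt.
  have c0 : 0 < c by have [] := diag_range xD'.
  have [lt'|lt'|e] := ltngtP (entry D T (c, r)) (entry D T (c.+1, r')).
  + have [zD zy] := P3 _ _ _ xD' yD' rr' lt'; split=> //.
    apply: lt_es => // e1 e2; have := asc _ _ zD yD' e1 e2.
    by rewrite /readlt /= [c.+1 == 1]eqSS (gtn_eqF c0); lia.
  + rewrite !es // in lt; have [e1 e2] := swapv_ltn lt lt'.
    have := asc _ _ yD' xD' e1 e2; rewrite /readlt /=; lia.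
  + by have := entry_inj Dn TF xD' yD' e => -[]; lia.
- move=> r r0 bD; have [b2 lt] := P4 _ r0 bD; split=> //.
  by apply: lt_es => // e1 e2; have := asc _ _ b2 bD e1 e2.
Qed.

Lemma SPYCT_fillings : {subset SPYCT alpha <= fillings n}.
Proof. by move=> T /(SPYCTP alpha_comp) [/SYCTP []]. Qed.

Lemma SPYCT_uniq : uniq (SPYCT alpha).
Proof. by rewrite !filter_uniq ?permutations_uniq. Qed.

Lemma SPYCT_asc_compat : asc_compat n (SPYCT alpha).
Proof.
move=> S S' i j SU SU' ir jr iS jS e1 e2; rewrite !swap_SPYCT //.
by rewrite /box_of e1 e2.
Qed.

Lemma peakYQS_sum (F : fieldType) (ch : forall n, supermod F n -> series F) :
  is_peak_char ch ->
  peakYQS ch alpha = (\sum_(T <- SPYCT alpha) peakK F (comp_of n (peak (desT T))))%R.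
Proof.
move=> chP; apply: ch_diagH chP SPYCT_uniq SPYCT_fillings SPYCT_asc_compat.
Qed.

End AscentCompatible.

(** * Peaks between first-column entries, and the row filling *)

Section Dominance.
Variable alpha : seq nat.
Hypothesis alpha_peak : is_peak_comp alpha.
Let alpha_comp : is_comp alpha. Proof. by case/andP: alpha_peak. Qed.
Local Notation D := (diag alpha).
Local Notation n := (sumn alpha).
Let Du : uniq D := diag_uniq alpha.
Let Dn : size D = n := size_diag alpha.
Let in_col1 r : ((1, r) \in D) = (0 < r <= size alpha) := diag_col1 alpha_comp r.

(** Let a = T(1, r) and b = T(1, r+1). If a were a descent, a+1 would stand higher in the first
    column, where entries are at least b > a+1. If b-1 were an ascent, it would stand above b in the
    first column. So the least descent above a is a peak, and it is at most b-1. *)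
Lemma peak_between T r : T \in SPYCT alpha -> 0 < r < size alpha ->
  exists2 p, p \in peak (desT T) & entry D T (1, r) < p < entry D T (1, r.+1).
Proof.
move=> /(SPYCTP alpha_comp) [/SYCTP [TF P1 P2 P3] P4] /andP [r0 rs].
have rD : (1, r) \in D by rewrite in_col1 r0 ltnW.
have r1D : (1, r.+1) \in D by rewrite in_col1.
have [b2 l2] := P4 _ r0 r1D; have l1 := P1 _ _ _ rD b2 isT.
have ra := entry_range Dn TF rD; have rb := entry_range Dn TF r1D.
set a := entry D T (1, r) in l1 ra *; set b := entry D T (1, r.+1) in l2 rb *.
have ab : a.+1 < b := leq_ltn_trans l1 l2.
have a_asc : a \notin desT T.
  apply/negP => ad; have Sa : 0 < a.+1 <= n by lia.
  have yD := mem_box_of Dn TF Sa; have ey := box_ofK Du Dn TF Sa.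
  have := descent_readlt TF ad rD yD erefl ey.
  move: yD ey; case: (box_of _ _ _) => c r' yD ey; have [c0 _ _ _] := diag_range yD.
  rewrite /readlt /=; case: (ltngtP c 1) => //=; first lia.
  move=> c1 rr'; rewrite c1 in yD ey.
  have : b <= a.+1; last lia.
  rewrite -ey /b; have [->//|ne] := eqVneq r' r.+1.
  by apply: ltnW; apply: P2 => //; lia.
have b_des : b.-1 \in desT T.
  apply/negPn/negP => ba; have br : 0 < b.-1 < n by lia.
  have br' : 0 < b.-1 <= n by lia.
  have xD := mem_box_of Dn TF br'; have ex := box_ofK Du Dn TF br'.
  have := ascent_readlt TF br ba xD r1D ex; rewrite prednK; last lia.
  move=> /(_ erefl); move: xD ex; case: (box_of _ _ _) => c r' xD ex; have [c0 _ _ _] := diag_range xD.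
  rewrite /readlt /=; case: (ltngtP c 1) => //=; first lia.
  move=> c1 rr'; rewrite c1 in xD ex.
  by have := P2 _ _ r1D xD rr'; rewrite ex -/b; lia.
have ex : exists p, (p \in desT T) && (a < p) by exists b.-1; rewrite b_des; lia.
case: (ex_minnP ex) => p /andP [pT ap] pmin.
exists p; last by have := pmin b.-1; rewrite b_des /=; lia.
rewrite mem_filter pT andbT; apply/andP; split; first by lia.
have [->//|ne] := eqVneq p.-1 a.
by apply/negP => pd; have := pmin p.-1; rewrite pd /=; lia.
Qed.

(** Rows above row r contain only entries at least T(1, r+1), so all smaller entries fit into the
    first r rows. *)
Lemma col1_bound T r : T \in SPYCT alpha -> 0 < r < size alpha ->
  entry D T (1, r.+1) <= (sumn (take r alpha)).+1.
Proof.
move=> /(SPYCTP alpha_comp) [/SYCTP [TF P1 P2 P3] P4] /andP [r0 rs].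
have r1D : (1, r.+1) \in D by rewrite in_col1.
have rb := entry_range Dn TF r1D; set b := entry D T (1, r.+1) in rb *.
have sz : size [seq box_of D T e | e <- iota 1 b.-1] <= size (diag (take r alpha)).
  apply: uniq_leq_size.
    rewrite map_inj_in_uniq ?iota_uniq // => e e'; rewrite !mem_iota => er e'r eq_b.
    by rewrite -(@box_ofK _ _ _ Du Dn TF e) ?eq_b ?(box_ofK Du Dn TF) //; lia.
  move=> x /mapP [e]; rewrite mem_iota => er ->.
  have er' : 0 < e <= n by lia.
  have xD := mem_box_of Dn TF er'; have ex := box_ofK Du Dn TF er'.
  move: xD ex; case: (box_of _ _ _) => c r' xD ex; have [c0 r'0 r's cr] := diag_range xD.
  have r'r : r' <= r.
    rewrite leqNgt; apply/negP => rr'.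
    have cD : (1, r') \in D by rewrite in_col1 r'0.
    have l1 : entry D T (1, r') <= e.
      have [c1|c1] := eqVneq c 1; first by rewrite -ex c1.
      by rewrite -ex; apply: ltnW; apply: P1 => //; lia.
    have l2 : b <= entry D T (1, r').
      have [->//|ne] := eqVneq r' r.+1.
      by apply: ltnW; apply: P2 => //; lia.
    by lia.
  rewrite mem_diag /in_diag /= size_take rs r'0 r'r c0 nth_take //; lia.
by rewrite size_map size_iota size_diag in sz; lia.
Qed.

Lemma sumn_take_nth s r : 0 < r <= size s -> sumn (take r s) = sumn (take r.-1 s) + nth 0 s r.-1.
Proof.
case: r => // r /= rs; rewrite (take_nth 0) // -cats1 sumn_cat /= addn0 //.
Qed.

Lemma leq_sumn_take (s : seq nat) r r' : r <= r' -> sumn (take r s) <= sumn (take r' s).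
Proof.
by elim: s r r' => [|x s IH] [|r] [|r'] //= rr'; rewrite leq_add2l IH.
Qed.

(** The witness for the diagonal of the triangular system: its peak set is Des(alpha). *)
Definition row_filling : seq nat := [seq sumn (take b.2.-1 alpha) + b.1 | b <- D].

Let entryR b : b \in D -> entry D row_filling b = sumn (take b.2.-1 alpha) + b.1.
Proof. by move=> bD; rewrite /entry (nth_map (0, 0)) ?index_mem // nth_index. Qed.

Let row_lt c c' r r' : (c, r) \in D -> (c', r') \in D -> r < r' ->
  sumn (take r.-1 alpha) + c < sumn (take r'.-1 alpha) + c'.
Proof.
move=> /diag_range [c0 r0 rs cr] /diag_range [c'0 r'0 r's cr'] rr'.
apply: (@leq_ltn_trans (sumn (take r alpha))).
  by rewrite (@sumn_take_nth _ r) ?r0 // leq_add2l.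
apply: (@leq_ltn_trans (sumn (take r'.-1 alpha))); last by lia.
by apply: leq_sumn_take; lia.
Qed.

Lemma row_filling_fillings : row_filling \in fillings n.
Proof.
rewrite mem_fillings.
have u : uniq row_filling.
  rewrite map_inj_in_uniq // => -[c r] [c' r'] xD yD /= e.
  case: (ltngtP r r') => [l|l|rr]; first by have := row_lt xD yD l; lia.
    by have := row_lt yD xD l; lia.
  by rewrite rr in e *; congr (_, _); lia.
have sub : {subset row_filling <= iota 1 n}.
  move=> _ /mapP [[c r] xD ->] /=; have [c0 r0 rs cr] := diag_range xD.
  rewrite mem_iota; have : sumn (take r alpha) <= n.
    by rewrite /n -[in leqRHS](take_size alpha) leq_sumn_take.
  by rewrite (@sumn_take_nth _ r) ?r0 //; lia.
apply: uniq_perm; rewrite ?iota_uniq //.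
by have [] := uniq_min_size u sub ltac:(by rewrite size_iota size_map Dn).
Qed.

Lemma row_filling_SPYCT : row_filling \in SPYCT alpha.
Proof.
apply/(SPYCTP alpha_comp); split; first (apply/SYCTP; split; first exact: row_filling_fillings).
- by move=> c c' r xD yD cc'; rewrite !entryR //= ltn_add2l.
- by move=> r r' xD yD rr'; rewrite !entryR //=; exact: row_lt.
- move=> c r r' xD yD rr' lt; rewrite !entryR //= in lt.
  by have := row_lt yD xD rr'; lia.
- move=> r r0 r1D; have rs : r < size alpha by have [] := diag_range r1D.
  have b2 : (2, r) \in D.
    by rewrite mem_diag /in_diag /= r0 (ltnW rs) nth_peak_comp ?r0.
  by split=> //; rewrite !entryR //=; exact: (row_lt b2 r1D (ltnSn r)).
Qed.

Lemma mem_des i : (i \in des alpha) = has (fun r => i == sumn (take r alpha)) (iota 1 (size alpha).-1).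
Proof. by apply/mapP/hasP => [[r rI ->]|[r rI /eqP ->]]; exists r. Qed.

(** Inside a row the next entry is the right neighbour; after the end of a row it starts the row
    above, which is read earlier. *)
Lemma des_row_filling : desT row_filling = des alpha.
Proof.
have TF := row_filling_fillings.
apply: (irr_sorted_eq ltn_trans ltnn (desT_sorted _) (des_sorted alpha_comp)) => i.
have [ir|ir] := boolP (0 < i < n); last first.
  rewrite (mem_desT _ TF) (negPf ir); apply/esym/negP => /(allP (des_range alpha_comp)) h.
  by rewrite h in ir.
have br : 0 < i <= n by lia.
have xD := mem_box_of Dn TF br; have := box_ofK Du Dn TF br; rewrite entryR //.
move: xD; case: (box_of _ _ _) => c r xD /= ei; have [c0 r0 rs cr] := diag_range xD.
have ex : entry D row_filling (c, r) = i by rewrite entryR.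
have [cl|cl] := ltnP c (nth 0 alpha r.-1).
  have yD : (c.+1, r) \in D by rewrite mem_diag /in_diag /= r0 rs.
  have ey : entry D row_filling (c.+1, r) = i.+1 by rewrite entryR //= -ei addnS.
  have -> : i \in desT row_filling = false.
    apply/negP => id; have := descent_readlt TF id xD yD ex ey.
    by rewrite /readlt /=; lia.
  apply/esym/negP; rewrite mem_des => /hasP [r']; rewrite mem_iota => r'r /eqP e.
  have := sumn_take_nth (r := r) (s := alpha); rewrite r0 rs => /(_ isT) e'.
  case: (leqP r r') => rr'; first by have := @leq_sumn_take alpha _ _ rr'; lia.
  by have := @leq_sumn_take alpha r' r.-1; lia.
have ce : c = nth 0 alpha r.-1 by lia.
have ei' : i = sumn (take r alpha) by rewrite -ei ce -sumn_take_nth // r0.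
have rs' : r < size alpha.
  rewrite ltn_neqAle rs andbT; apply/eqP => e; rewrite e take_size in ei'.
  by move: ir; rewrite ei' ltnn andbF.
have yD : (1, r.+1) \in D by rewrite in_col1.
have ey : entry D row_filling (1, r.+1) = i.+1 by rewrite entryR //= -ei' addn1.
have -> : i \in desT row_filling.
  apply/negPn/negP => id; have := ascent_readlt TF ir id xD yD ex ey.
  by rewrite /readlt /=; case: (c == 1); lia.
by apply/esym; rewrite mem_des; apply/hasP; exists r; rewrite ?mem_iota ?ei' //; lia.
Qed.

Lemma peak_des : peak (des alpha) = des alpha.
Proof.
apply/all_filterP/allP => _ /mapP [r + ->]; rewrite mem_iota => rr.
have := sumn_take_nth (r := r) (s := alpha) ltac:(lia).
have : 1 < nth 0 alpha r.-1 by apply: nth_peak_comp => //; lia.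
move=> h2 e; apply/andP; split; first by lia.
rewrite mem_des; apply/hasPn => r'; rewrite mem_iota => r'r; apply/eqP => e'.
case: (leqP r r') => l; first by have := @leq_sumn_take alpha _ _ l; lia.
by have := @leq_sumn_take alpha r' r.-1; lia.
Qed.

End Dominance.

(** * Strict partitions *)

Definition reread (D1 D2 : seq box) (T : seq nat) := [seq entry D1 T b | b <- D2].

Section Reread.
Variables (D1 D2 : seq box) (n : nat).
Hypotheses (D1n : size D1 = n) (D1u : uniq D1) (D12 : perm_eq D1 D2).

Lemma entry_reread T b : b \in D2 -> entry D2 (reread D1 D2 T) b = entry D1 T b.
Proof. by move=> bD; rewrite /entry (nth_map (0, 0)) ?index_mem // nth_index. Qed.

Lemma reread_fillings T : T \in fillings n -> reread D1 D2 T \in fillings n.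
Proof.
move=> TF; move: (TF); rewrite !mem_fillings; apply: perm_trans.
by rewrite -[X in perm_eq _ X](map_entry D1u D1n TF) perm_map // perm_sym.
Qed.

Lemma rereadK T : T \in fillings n -> reread D2 D1 (reread D1 D2 T) = T.
Proof.
move=> TF; rewrite -[RHS](map_entry D1u D1n TF); apply/eq_in_map => b bD.
by rewrite entry_reread // -(perm_mem D12).
Qed.

End Reread.

Section StrictPartition.
Variable lambda : seq nat.
Hypothesis lambda_strict : is_strict_part lambda.
Local Notation D := (diag lambda).
Local Notation n := (sumn lambda).

Let lambda_comp : is_comp lambda. Proof. by case/andP: lambda_strict. Qed.

Lemma strict_nth r r' : 0 < r' -> r' <= r -> r <= size lambda ->
  nth 0 lambda r.-1 + (r - r') <= nth 0 lambda r'.-1.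
Proof.
move=> r'0; elim: r => [|r IH]; first by lia.
rewrite leq_eqVlt => /orP [/eqP ->|r'r rs]; first by rewrite subnn addn0.
have {}IH := IH r'r (ltnW rs).
have : nth 0 lambda r < nth 0 lambda r.-1; last by rewrite /=; lia.
case/andP: lambda_strict => _ /(sortedP 0) /(_ r.-1) h.
by have := h ltac:(lia); rewrite prednK //; lia.
Qed.

Lemma strict_peak_comp : is_peak_comp lambda.
Proof.
rewrite /is_peak_comp lambda_comp; apply/(all_nthP 0) => i.
rewrite size_takel ?leq_pred // => im; rewrite nth_take //.
have := @strict_nth i.+2 i.+1 isT (leqnSn _) ltac:(lia).
have := all_nthP 0 lambda_comp i.+1 ltac:(lia).
by rewrite /= subSnn; lia.
Qed.

(* ShD(lambda) moved to the left margin, still in the reading order of ShD. *)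
Definition rowdiag : seq box :=
  [seq (c, r) | r <- rev (iota 1 (size lambda)), c <- iota 1 (nth 0 lambda r.-1)].

Definition shift (b : box) : box := (b.1 + b.2.-1, b.2).

Lemma shift_inj : injective shift.
Proof. by move=> [c r] [c' r'] [/= + e]; rewrite e => /addIn ->. Qed.

Lemma map_shift : map shift rowdiag = shdiag lambda.
Proof.
rewrite /rowdiag /shdiag map_allpairs; congr flatten; apply/eq_in_map => r.
rewrite mem_rev mem_iota => /andP [r0 _].
have -> : iota r (nth 0 lambda r.-1) = map (addn r.-1) (iota 1 (nth 0 lambda r.-1)).
  by rewrite -iotaDl addn1 prednK.
by rewrite -map_comp; apply: eq_map => c; rewrite /shift /= addnC.
Qed.

Lemma entry_shift S b : entry (shdiag lambda) S (shift b) = entry rowdiag S b.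
Proof. by rewrite /entry -map_shift index_map //; exact: shift_inj. Qed.

Definition rowlt : rel box := fun b b' => (b'.2 < b.2) || ((b.2 == b'.2) && (b.1 < b'.1)).

Lemma rowlt_irr : irreflexive rowlt.
Proof. by move=> b; rewrite /rowlt !ltnn andbF. Qed.

Lemma rowlt_trans : transitive rowlt.
Proof. move=> [c2 r2] [c1 r1] [c3 r3]; rewrite /rowlt /=; lia. Qed.

Lemma rowdiag_sorted : sorted rowlt rowdiag.
Proof.
rewrite (sorted_pairwise rowlt_trans).
apply: (pairwise_allpairs_dep (f := fun r c => (c, r)) (P := gtn)).
- by rewrite -(sorted_pairwise (rev_trans ltn_trans)) rev_sorted iota_ltn_sorted.
- by move=> r r' c c' _ rr'; rewrite /rowlt /= (rr' : r' < r).
- move=> r _; have := iota_ltn_sorted 1 (nth 0 lambda r.-1).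
  rewrite (sorted_pairwise ltn_trans); apply: sub_pairwise => c c' cc'.
  by rewrite /rowlt /= eqxx (cc' : c < c') orbT.
Qed.

Lemma rowdiag_uniq : uniq rowdiag.
Proof. exact: sorted_uniq rowlt_trans rowlt_irr _ rowdiag_sorted. Qed.

Lemma mem_rowdiag : rowdiag =i D.
Proof.
move=> [c r]; rewrite mem_diag /in_diag /=.
apply/allpairsPdep/andP => [[r' [c' [+ + [-> ->]]]]|[r1 c1]].
  by rewrite mem_rev !mem_iota !add1n !ltnS => -> ->.
by exists r, c; rewrite mem_rev !mem_iota !add1n !ltnS r1 c1.
Qed.

Lemma perm_rowdiag : perm_eq rowdiag D.
Proof. exact: uniq_perm rowdiag_uniq (diag_uniq _) mem_rowdiag. Qed.

Lemma size_rowdiag : size rowdiag = n.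
Proof. by rewrite (perm_size perm_rowdiag) size_diag. Qed.

(** Monotonicity along rows and columns of ShD(lambda) in left-justified coordinates: the shift puts
    (c, r) in column c + r - 1. *)
Definition shifted_incr (e : box -> nat) := forall c r c' r', (c, r) \in D -> (c', r') \in D ->
  ((r == r') && (c < c')) || ((c + r == c' + r') && (r < r')) -> e (c, r) < e (c', r').

Lemma SShTP S : reflect (S \in fillings n /\ shifted_incr (entry rowdiag S)) (S \in SShT lambda).
Proof.
rewrite mem_filter; apply: (iffP andP) => [[h SF]|[SF h]]; split=> //.
  move=> c r c' r' bD b'D cond.
  have [_ r0 _ _] := diag_range bD; have [_ r'0 _ _] := diag_range b'D.
  have m b : b \in D -> shift b \in shdiag lambda.
    by move=> bD'; rewrite -map_shift map_f // mem_rowdiag.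
  have := allP (allP h _ (m _ bD)) _ (m _ b'D); rewrite !entry_shift /=.
  by move/implyP; apply; lia.
apply/allP => x; rewrite -map_shift => /mapP [[c r] bD ->].
apply/allP => y /mapP [[c' r'] b'D ->]; apply/implyP; rewrite map_shift !entry_shift /=.
rewrite !mem_rowdiag in bD b'D => cond; apply: h => //.
have [_ r0 _ _] := diag_range bD; have [_ r'0 _ _] := diag_range b'D.
by lia.
Qed.

(** Go down the shifted column to (c + (r - r'), r'), then left along row r'. Strictness of lambda
    keeps these boxes in the diagram. *)
Lemma shifted_lt T c r c' r' : shifted_incr T -> (c, r) \in D -> r' < r -> 0 < r' -> 0 < c' <= c.+1 ->
  (c', r') \in D /\ T (c', r') < T (c, r).
Proof.
move=> Ti xD rr' r'0 cc'; have [c0 r0 rs cr] := diag_range xD.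
have sn := strict_nth r'0 (ltnW rr') rs.
have zD : (c + (r - r'), r') \in D by rewrite mem_diag /in_diag /=; lia.
have zx : T (c + (r - r'), r') < T (c, r).
  by apply: Ti => //; apply/orP; right; rewrite rr' andbT; lia.
have yD : (c', r') \in D by rewrite mem_diag /in_diag /=; lia.
split=> //; apply: leq_ltn_trans zx.
have [e|ne] := eqVneq c' (c + (r - r')); first by rewrite e.
by apply: ltnW; apply: Ti => //; rewrite eqxx /=; lia.
Qed.

(** The key is T(c+1, r) < T(c, r+1), one step in a shifted column, which is then iterated.
    Conversely, [shifted_lt] contradicts the premise of the triple rule and yields the first-column
    and peak rules. *)
Lemma SPYCT_strictP T :
  reflect (T \in fillings n /\ shifted_incr (entry D T)) (T \in SPYCT lambda).
Proof.
apply: (iffP (SPYCTP lambda_comp T)) => [[/SYCTP [TF P1 P2 P3] P4]|[TF Ti]].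
  split=> //.
  (* If the diagonal step failed at (c, r), the triple rule would propagate   *)
  (* the failure along row r, beyond the end of the row.                      *)
  have diag_step c r : (c, r.+1) \in D -> 0 < r -> entry D T (c.+1, r) < entry D T (c, r.+1).
    have [m] := ubnP (nth 0 lambda r - c); elim: m c => // m IH c cm xD r0.
    have [c0 _ rs cr] := diag_range xD.
    have sn := strict_nth r0 (leqnSn r) rs; rewrite subSnn /= in sn cr.
    have yD : (c.+1, r) \in D by rewrite mem_diag /in_diag /=; lia.
    rewrite ltnNge leq_eqVlt negb_or; apply/andP; split.
      apply/eqP => /(entry_inj (size_diag _) TF xD yD) []; lia.
    apply/negP => lt; have [zD lz] := P3 _ _ _ xD yD (ltnSn r) lt.
    have [_ _ _ /= zr] := diag_range zD.
    have wD : (c.+2, r) \in D by rewrite mem_diag /in_diag /=; lia.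
    have wz := IH c.+1 ltac:(lia) zD r0.
    by have := ltn_trans (ltn_trans lz (P1 _ _ _ yD wD (ltnSn _))) wz; rewrite ltnn.
  move=> c r c' r' bD b'D /orP [/andP [/eqP e cc']|/andP [/eqP e rr']].
    by rewrite -e in b'D *; apply: P1.
  have [c'0 r'0 r's cr'] := diag_range b'D; have [c0 r0 _ _] := diag_range bD.
  have [k kE] : exists k, r' = r + k.+1 by exists (r' - r).-1; lia.
  elim: k r' c' kE e b'D {rr' c'0 r'0 r's cr'} => [|k IH] r' c' kE e b'D.
    have -> : c = c'.+1 by lia.
    by rewrite kE addn1 in b'D *; apply: diag_step.
  have [c'0 r'0 r's cr'] := diag_range b'D.
  rewrite kE addnS /= in b'D r's cr' *.
  have lt := diag_step _ _ b'D ltac:(lia).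
  apply: ltn_trans lt; apply: IH => //; first by lia.
  have := @strict_nth (r + k.+1).+1 (r + k.+1) ltac:(lia) (leqnSn _) ltac:(lia).
  by rewrite mem_diag /in_diag /= subSnn; lia.
split; first (apply/SYCTP; split=> //).
- by move=> c c' r xD yD cc'; apply: Ti => //; rewrite eqxx cc'.
- move=> r r' xD yD rr'; have [_ r0 _ _] := diag_range xD.
  by have [] := shifted_lt (c' := 1) Ti yD rr' r0 isT.
- move=> c r r' xD yD rr' lt; have [c0 r'0 _ _] := diag_range yD.
  have [_ lt'] := shifted_lt (c' := c.+1) Ti xD rr' r'0 ltac:(lia).
  by have := ltn_trans lt lt'; rewrite ltnn.
- by move=> r r0 xD; apply: (shifted_lt (c' := 2) Ti xD).
Qed.

(** Let i and i+1 be in boxes (c1, r1) and (c2, r2). If r1 < r2, then c2 < c1, as otherwise T(c1+1,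
    r1) would lie strictly between i and i+1. If r1 > r2, then c2 > c1+1 by [shifted_lt]. In these
    positions, and within a row, both orders read the same box first. *)
Lemma desT_reread T : T \in SPYCT lambda -> desT (reread D rowdiag T) = desT T.
Proof.
move=> /SPYCT_strictP [TF Ti].
have pD : perm_eq D rowdiag by rewrite perm_sym perm_rowdiag.
have SF := reread_fillings (size_diag _) (diag_uniq _) pD TF.
apply: (irr_sorted_eq ltn_trans ltnn (desT_sorted _) (desT_sorted _)) => i.
have [ir|ir] := boolP (0 < i < n); last first.
  by rewrite (mem_desT _ TF) (mem_desT _ SF) (negPf ir).
have bE e : 0 < e <= n -> box_of rowdiag (reread D rowdiag T) e = box_of D T e.
  move=> er; have xD := mem_box_of (size_diag _) TF er.
  rewrite -[in LHS](box_ofK (diag_uniq _) (size_diag _) TF er).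
  rewrite -(@entry_reread D rowdiag) ?mem_rowdiag // (entryK size_rowdiag SF) //.
  by rewrite mem_rowdiag.
have b1 : 0 < i <= n by lia.
have b2 : 0 < i.+1 <= n by lia.
rewrite (mem_desT_index rowdiag_uniq size_rowdiag SF ir) !bE //.
rewrite (mem_desT_index (diag_uniq _) (size_diag _) TF ir).
have xD := mem_box_of (size_diag _) TF b1; have yD := mem_box_of (size_diag _) TF b2.
have ex := box_ofK (diag_uniq _) (size_diag _) TF b1.
have ey := box_ofK (diag_uniq _) (size_diag _) TF b2.
rewrite index_diag // (index_sorted_rel rowlt_irr rowlt_trans rowdiag_sorted) ?mem_rowdiag //.
move: xD yD ex ey; case: (box_of D T i) => c1 r1; case: (box_of D T i.+1) => c2 r2 xD yD ex ey.
have [c10 r10 _ _] := diag_range xD; have [c20 r20 _ _] := diag_range yD.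
rewrite /readlt /rowlt /=; case: (ltngtP r1 r2) => [r12|r21|r12] /=.
- have [c12|c21] := leqP c1 c2; last by [].
  have [zD lt] := shifted_lt (c' := c1.+1) Ti yD r12 r10 ltac:(lia).
  have := Ti _ _ _ _ xD zD ltac:(by rewrite eqxx ltnSn).
  by move: lt; rewrite ex ey ltnS => l1 l2; have := leq_trans l2 l1; rewrite ltnn.
- have [c21|c12] := leqP c2 c1.+1.
    have [_] := shifted_lt (c' := c2) Ti xD r21 r20 ltac:(lia).
    by rewrite ex ey ltnNge leqnSn.
  by lia.
- rewrite -r12 in yD ey *; have [c12|c21|c12] := ltngtP c1 c2.
  + by lia.
  + by have := Ti _ _ _ _ yD xD ltac:(by rewrite eqxx c21); rewrite ex ey ltnNge leqnSn.
  + by move: ey; rewrite -c12 ex; lia.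
Qed.

Lemma schurQ_sum (F : fieldType) : schurQ F lambda =
  (\sum_(T <- SPYCT lambda) peakK F (comp_of n (peak (desT T))))%R.
Proof.
have pD : perm_eq D rowdiag by rewrite perm_sym perm_rowdiag.
have SF := SPYCT_fillings lambda_comp.
have DK T : T \in SPYCT lambda -> reread rowdiag D (reread D rowdiag T) = T.
  by move=> /SF TF; apply: rereadK (size_diag _) (diag_uniq _) pD _ TF.
have p : perm_eq (SShT lambda) [seq reread D rowdiag T | T <- SPYCT lambda].
  apply: uniq_perm; first by rewrite filter_uniq // permutations_uniq.
    by rewrite map_inj_in_uniq ?SPYCT_uniq // => T T' TS T'S e; rewrite -(DK T) // e DK.
  move=> S; apply/SShTP/mapP => [[SFi Si]|[T /SPYCT_strictP [TF Ti] ->]].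
    exists (reread rowdiag D S); last by rewrite (rereadK size_rowdiag rowdiag_uniq perm_rowdiag).
    apply/SPYCT_strictP; split; first exact: reread_fillings size_rowdiag rowdiag_uniq perm_rowdiag _ SFi.
    by move=> c r c' r' bD b'D cond; rewrite !entry_reread //; apply: Si.
  split; first exact: reread_fillings (size_diag _) (diag_uniq _) pD _ TF.
  by move=> c r c' r' bD b'D cond; rewrite !entry_reread ?mem_rowdiag //; apply: Ti.
rewrite /schurQ (perm_big _ p) big_map /= big_seq [RHS]big_seq.
by apply: eq_bigr => T TS; rewrite desT_reread.
Qed.

End StrictPartition.

(** * Triangularity *)

Section Weight.
Implicit Types (X Y P : seq nat) (n : nat).

(** For X = Des(alpha) and n the size of alpha, this is the sum of the (i-1) alpha_i. *)
Definition wt n X := \sum_(p <- X) (n - p).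

Lemma wt_subset n X Y : uniq X -> uniq Y -> all (ltn^~ n) X -> {subset Y <= X} ->
  wt n Y <= wt n X /\ (wt n Y = wt n X -> Y =i X).
Proof.
move=> uX uY Xn YX; pose Z := [seq x <- X | x \notin Y].
have pX : perm_eq X (Y ++ Z).
  apply: uniq_perm => // [|x].
    rewrite cat_uniq uY filter_uniq // andbT; apply/hasPn => x.
    by rewrite mem_filter => /andP [].
  rewrite mem_cat mem_filter; case: (boolP (x \in Y)) => //= xY; exact: YX.
have e : wt n X = wt n Y + wt n Z by rewrite /wt (perm_big _ pX) big_cat.
split=> [|eXY x]; first by rewrite e leq_addr.
have /eqP : wt n Z = 0 by lia.
rewrite sum_nat_seq_eq0 => /allP Z0.
rewrite (perm_mem pX) mem_cat; case: (boolP (x \in Y)) => //= _.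
apply/esym/negP => xZ; have := Z0 _ xZ; move: xZ; rewrite mem_filter => /andP [_ /(allP Xn)] /=.
by lia.
Qed.

(** Lowering elements raises the weight and so does enlarging the set: wt Y <= wt t(Y) <= wt X. As
    all elements are below n, equality forces t to fix Y and t(Y) to be X. *)
Lemma wt_dominated n X Y (t : nat -> nat) : uniq X -> uniq Y ->
  all (ltn^~ n) X -> all (ltn^~ n) Y ->
  {in Y &, injective t} -> {in Y, forall y, t y \in X /\ t y <= y} ->
  wt n Y <= wt n X /\ (wt n Y = wt n X -> Y =i X).
Proof.
move=> uX uY Xn Yn ti tX.
have u : uniq (map t Y) by rewrite map_inj_in_uniq.
have s : {subset map t Y <= X} by move=> _ /mapP [y yY ->]; case: (tX _ yY).
have [le1 eq1] := wt_subset uX u Xn s.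
have e : wt n (map t Y) = wt n Y + \sum_(y <- Y) (y - t y).
  rewrite /wt big_map -big_split /= big_seq [RHS]big_seq.
  by apply: eq_bigr => y yY; have := allP Yn _ yY; have [_] := tX _ yY; rewrite /=; lia.
split=> [|eXY x]; first by lia.
have e1 : wt n (map t Y) = wt n X by lia.
have /eqP : \sum_(y <- Y) (y - t y) = 0 by lia.
rewrite sum_nat_seq_eq0 => /allP t0; rewrite -(eq1 e1).
suff -> : map t Y = Y by [].
rewrite -[RHS]map_id; apply/eq_in_map => y yY.
by have := t0 _ yY; have [_] := tX _ yY; rewrite /=; lia.
Qed.

End Weight.

Lemma peak_pred X p : p \in peak X -> p.-1 \notin peak X.
Proof. by rewrite mem_filter => /andP [/andP [_ pX] _]; rewrite mem_filter negb_and pX orbT. Qed.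

Lemma peak_gt1 X p : p \in peak X -> 1 < p.
Proof. by rewrite mem_filter => /andP [/andP []]. Qed.

Lemma peakK_id X : peak (peak X) = peak X.
Proof. by apply/all_filterP/allP => p pX; rewrite (peak_gt1 pX) peak_pred. Qed.

(** A part 1 before the last would give two consecutive descents or the descent 1, which is
    impossible if all descents are peaks. *)
Lemma peak_compP beta : is_comp beta -> peak (des beta) = des beta -> is_peak_comp beta.
Proof.
move=> cb pb; rewrite /is_peak_comp cb; apply/(all_nthP 0) => i.
rewrite size_takel ?leq_pred // => im; rewrite nth_take //.
have ib : i < size beta by lia.
have iD k : 0 < k < size beta -> sumn (take k beta) \in des beta.
  by move=> kb; apply/mapP; exists k => //; rewrite mem_iota; lia.
have dp : sumn (take i.+1 beta) \in peak (des beta) by rewrite pb iD //; lia.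
have := @sumn_take_nth beta i.+1 ltac:(lia); rewrite /= => e.
have b0 := all_nthP 0 cb i ib.
rewrite ltn_neqAle b0 andbT; apply/eqP => b1.
have [i0|i0] := posnP i; first by have := peak_gt1 dp; rewrite e -b1 i0 take0.
by have := peak_pred dp; rewrite pb e -b1 addn1 /= iD // i0.
Qed.

(** * Closure properties of spans *)

Section Span.
Variables (F : fieldType) (V : lmodType F) (I : eqType) (P : pred I) (v : I -> V).
Local Open Scope ring_scope.

(** Witnesses of [in_span] may repeat an index; over a common duplicate-free list repetitions become
    coefficients, so that combinations can be added. *)
Lemma sum_count_mem (s r : seq I) (f : I -> V) : uniq r -> {subset s <= r} ->
  \sum_(i <- s) f i = \sum_(i <- r) f i *+ count_mem i s.
Proof.
move=> ur; elim: s => [|j s IH] sr; first by rewrite big_nil big1.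
rewrite big_cons IH => [|i si]; last by apply: sr; rewrite inE si orbT.
have jr : j \in r by apply: sr; exact: mem_head.
rewrite !(bigD1_seq j jr ur) /= eqxx mulrnDr addrA mulr1n; congr (_ + _).
by apply: eq_bigr => i ij; rewrite eq_sym (negPf ij) add0n.
Qed.

Lemma in_span0 : in_span P v 0.
Proof. by exists [::], (fun=> 0); rewrite big_nil. Qed.

Lemma in_span_gen i : P i -> in_span P v (v i).
Proof. by move=> Pi; exists [:: i], (fun=> 1); rewrite big_seq1 scale1r /= Pi. Qed.

Lemma in_span_linear c x y : in_span P v x -> in_span P v y -> in_span P v (c *: x + y).
Proof.
move=> [s [a [sP ->]]] [t [b [tP ->]]]; pose r := undup (s ++ t).
have ur : uniq r by exact: undup_uniq.
have sr : {subset s <= r} by move=> i si; rewrite mem_undup mem_cat si.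
have tr : {subset t <= r} by move=> i ti; rewrite mem_undup mem_cat ti orbT.
exists r, (fun i => c * a i *+ count_mem i s + b i *+ count_mem i t); split.
  by apply/allP => i; rewrite mem_undup mem_cat => /orP [/(allP sP)|/(allP tP)].
rewrite (sum_count_mem _ ur sr) (sum_count_mem _ ur tr) scaler_sumr -big_split.
apply: eq_bigr => i _ /=; rewrite scalerDl -!scalerMnl; congr (_ + _).
by rewrite -scalerMnr scalerA.
Qed.

Lemma in_span_sum (J : Type) (s : seq J) (Q : pred J) (f : J -> V) :
  (forall j, Q j -> in_span P v (f j)) -> in_span P v (\sum_(j <- s | Q j) f j).
Proof.
move=> h; elim/big_rec: _ => [|j x Qj xP]; first exact: in_span0.
by rewrite -[f j]scale1r; apply: in_span_linear => //; exact: h.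
Qed.

End Span.

(** * Coefficients on the monomials x^alpha *)

Section Coefficients.
Variable F : fieldType.
Local Open Scope ring_scope.
Hypothesis F0 : forall k, ((k%:R == 0 :> F) = (k == 0%N)).

(* The monomial x_1^(a_1) x_2^(a_2) ..., where (a_1, a_2, ...) is the         *)
(* composition of n with descent set P.                                       *)
Definition mono_word n (P : seq nat) := [seq count (leq^~ k) P | k <- iota 0 n].
Definition mono n P : {mset nat}%mset := seq_mset (mono_word n P).

Lemma mono_word_sorted n P : sorted leq (mono_word n P).
Proof.
rewrite /mono_word; apply: (homo_sorted (e := leq)) (iota_sorted 0 n) => x y xy.
by apply: sub_count => z /= /leq_trans; apply.
Qed.

Lemma mono_word_step n P j : uniq P -> (0 < j < n)%N ->
  (nth 0 (mono_word n P) j.-1 < nth 0 (mono_word n P) j)%N = (j \in P).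
Proof.
move=> uP jn; rewrite !(nth_map 0%N) ?size_iota ?nth_iota; try lia.
rewrite !add0n; have -> : count (leq^~ j) P = (count (leq^~ j.-1) P + (j \in P))%N.
  rewrite -count_uniq_mem // -count_predUI [count (predI _ _) _](eq_count (a2 := pred0)) ?count_pred0 ?addn0.
    by apply: eq_count => x /=; lia.
  by move=> x /=; lia.
by case: (j \in P); lia.
Qed.

(** A multiset has a single weakly increasing arrangement, here [mono_word n P], and that word
    increases strictly exactly at the positions in [P]. *)
Lemma fundQS_coef n P beta : uniq P -> is_comp beta ->
  fundQS F beta (mono n P) = ((sumn beta == n) && all (mem P) (des beta))%:R.
Proof.
move=> uP cb; rewrite /fundQS; congr (_%:R).
set a := (X in count X _); set w := mono_word n P; set l := permutations _.
have wl : w \in l by rewrite mem_permutations perm_sym perm_eq_seq_mset.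
have aw s : s \in l -> a s -> s = w.
  rewrite mem_permutations => sw /and3P [_ ss _].
  apply: (sorted_eq leq_trans anti_leq ss (mono_word_sorted n P)).
  exact: perm_trans sw (perm_eq_seq_mset _).
have -> : count a l = a w.
  rewrite -[RHS]muln1 -[1%N]/(nat_of_bool true) -wl -(count_uniq_mem w) ?permutations_uniq //.
  case aE: (a w); rewrite ?mul1n ?mul0n.
    apply: eq_in_count => s sl /=; apply/idP/eqP => [/aw -> //|-> //].
  apply/eqP; rewrite -leqn0 leqNgt -has_count; apply/hasPn => s sl.
  by apply/negP => /[dup] /(aw _ sl) ->; rewrite aE.
congr nat_of_bool; rewrite /a size_map size_iota mono_word_sorted /= eq_sym.
have [e|//] := eqVneq (sumn beta) n.
apply: eq_in_all => j jb; have := allP (des_range cb) _ jb; rewrite e => jn.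
exact: mono_word_step.
Qed.

(** Kept as a natural number: by [F0] a sum of such coefficients vanishes in the field only if every
    one of them is 0. *)
Definition kcoef (alpha : seq nat) n (P : seq nat) : nat := (2 ^ (size (peak (des alpha))).+1 *
  \sum_(beta <- compositions (sumn alpha)
        | all (fun p => (p \in des beta) (+) (p \in [seq x.+1 | x <- des beta])) (peak (des alpha)))
     ((sumn beta == n) && all (mem P) (des beta)))%N.

Lemma peakK_coef alpha n P : uniq P -> peakK F alpha (mono n P) = (kcoef alpha n P)%:R.
Proof.
move=> uP; rewrite /peakK /kcoef natrM natr_sum.
transitivity ((2 ^ (size (peak (des alpha))).+1)%:R * (\sum_(beta <- compositions (sumn alpha)
        | all (fun p => (p \in des beta) (+) (p \in [seq x.+1 | x <- des beta])) (peak (des alpha)))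
     fundQS F beta) (mono n P)) => //.
congr (_ * _); rewrite fct_sumE big_seq_cond [RHS]big_seq_cond; apply: eq_bigr => beta.
rewrite mem_compositions => /andP [/andP [cb _] _]; exact: fundQS_coef.
Qed.

(** A contributing beta has Des(beta) inside P, and each peak p of alpha lies in Des(beta) or
    Des(beta)+1, so p or p-1 is in P. This choice is injective because peaks are never consecutive,
    and [wt_dominated] applies. *)
Lemma kcoef_neq0 alpha n P : is_comp alpha -> uniq P -> all (ltn^~ n) P ->
  kcoef alpha n P != 0%N ->
  [/\ sumn alpha = n, (wt n (peak (des alpha)) <= wt n P)%N &
      wt n (peak (des alpha)) = wt n P -> peak (des alpha) =i P].
Proof.
move=> ca uP Pn; rewrite muln_eq0 negb_or => /andP [_].
rewrite sum_nat_seq_neq0 => /hasP [beta]; rewrite mem_compositions => /andP [cb /eqP sb].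
move=> /andP [/allP pb]; rewrite eqb0 negbK => /andP [/eqP bn /allP bP].
have san : sumn alpha = n by rewrite -sb.
set Y := peak (des alpha) in pb *.
have uY : uniq Y by rewrite filter_uniq // (sorted_uniq ltn_trans ltnn) ?des_sorted.
have Yn : all (ltn^~ n) Y.
  by apply/allP => y; rewrite mem_filter => /andP [_ /(allP (des_range ca))]; rewrite san => /andP [].
pose t y := if y \in P then y else y.-1.
have tY y : y \in Y -> t y \in P /\ (t y <= y)%N.
  move=> yY; rewrite /t; case: ifP => yP; first by rewrite leqnn.
  split; last exact: leq_pred.
  have := pb _ yY; have -> : y \in des beta = false.
    by apply/negP => /bP /= yP'; rewrite yP' in yP.
  by rewrite addFb => /mapP [x xb ->]; apply: bP.
have ti : {in Y &, injective t}.
  move=> y y' yY y'Y; have := peak_pred yY; have := peak_pred y'Y.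
  have := peak_gt1 yY; have := peak_gt1 y'Y; rewrite -/Y /t => y1 y'1 py' py.
  case: ifP => _; case: ifP => _ // e; last by lia.
    by rewrite -e yY in py'.
  by rewrite e y'Y in py.
by have [] := wt_dominated uP uY Pn Yn ti tY.
Qed.

(** The summand beta = alpha contributes, since all descents of a peak composition are peaks and
    hence never consecutive. *)
Lemma kcoef_diag alpha : is_peak_comp alpha -> kcoef alpha (sumn alpha) (des alpha) != 0%N.
Proof.
move=> pa; have ca : is_comp alpha by case/andP: pa.
have pd := peak_des pa.
rewrite muln_eq0 expn_eq0 /= sum_nat_seq_neq0; apply/hasP; exists alpha.
  by rewrite mem_compositions ca eqxx.
rewrite eqxx /= eqb0 negbK; apply/andP; split; last by apply/allP.
rewrite pd; apply/allP => p pd'; rewrite pd' addTb; apply/mapP => -[x xd e].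
by have := peak_pred (X := des alpha) (p := p); rewrite pd pd' e /= xd => /(_ isT).
Qed.

(** The r-th descent of alpha is sent to a peak between the first entries of rows r and r+1. These
    intervals are disjoint, so the map is injective, and by [col1_bound] it never moves an element
    up; [wt_dominated] applies. *)
Lemma SPYCT_peak_wt alpha T (n := sumn alpha) : is_peak_comp alpha -> T \in SPYCT alpha ->
  (wt n (des alpha) <= wt n (peak (desT T)))%N /\
  (wt n (des alpha) = wt n (peak (desT T)) -> peak (desT T) = des alpha).
Proof.
move=> pa TS; have ca : is_comp alpha by case/andP: pa.
have TF := SPYCT_fillings ca TS.
have sP := peak_sorted (desT_sorted T); have rP := peak_range (desT_range TF).
have un X : sorted ltn X -> uniq X by apply: sorted_uniq; [exact: ltn_trans|exact: ltnn].
have rn X : all (fun i => 0 < i < n)%N X -> all (ltn^~ n) X.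
  by apply: sub_all => i /andP [].
(* Stated for every [r], with 0 out of range, so that [choice] gives a function. *)
have ex r : exists p, (0 < r < size alpha)%N ->
    (p \in peak (desT T)) && (entry (diag alpha) T (1, r) < p < entry (diag alpha) T (1, r.+1))%N.
  case: (boolP (0 < r < size alpha)%N) => [rs|_]; last by exists 0%N.
  by have [p p1 p2] := peak_between pa TS rs; exists p; rewrite p1.
have [p pP] := choice ex.
have mono_p r r' : (0 < r < r')%N -> (r' < size alpha)%N -> (p r < p r')%N.
  move=> rr' r's; have /andP [_ /andP [_ h1]] := pP r ltac:(lia).
  have /andP [_ /andP [h2 _]] := pP r' ltac:(lia).
  apply: ltn_trans h1 (leq_ltn_trans _ h2).
  have /(SPYCTP ca) [/SYCTP [_ _ P2 _] _] := TS.
  have [->//|ne] := eqVneq r' r.+1.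
  by apply: ltnW; apply: P2; rewrite ?diag_col1 //; lia.
(* List indices start at 0 and rows at 1, whence the successor. *)
pose t y := p (index y (des alpha)).+1.
have szd : size (des alpha) = (size alpha).-1 by rewrite size_map size_iota.
have ir y : y \in des alpha -> (0 < (index y (des alpha)).+1 < size alpha)%N.
  by rewrite -index_mem szd; lia.
have ti : {in des alpha &, injective t}.
  move=> y y' yd y'd; have := ir _ yd; have := ir _ y'd; rewrite /t.
  case: (ltngtP (index y (des alpha)) (index y' (des alpha))) => [l|l|e _ _ _].
  - by move=> h1 h2 e; have := mono_p (index y (des alpha)).+1 (index y' (des alpha)).+1 l (andP h1).2; rewrite e ltnn.
  - by move=> h1 h2 e; have := mono_p (index y' (des alpha)).+1 (index y (des alpha)).+1 l (andP h2).2; rewrite e ltnn.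
  - by rewrite -(nth_index 0%N yd) e nth_index.
have tX : {in des alpha, forall y, t y \in peak (desT T) /\ (t y <= y)%N}.
  move=> y yd; have r := ir _ yd; have /andP [h1 /andP [_ h2]] := pP _ r; split=> //.
  have := col1_bound pa TS r; have id : (index y (des alpha) < (size alpha).-1)%N by rewrite -szd index_mem.
  have <- : y = sumn (take (index y (des alpha)).+1 alpha).
    rewrite -[LHS](nth_index 0%N yd) (nth_map 0%N) ?size_iota // nth_iota //.
  by rewrite /t; lia.
have [w1 w2] := wt_dominated (un _ sP) (un _ (des_sorted ca)) (rn _ rP) (rn _ (des_range ca)) ti tX.
split=> // /w2 e; apply: (irr_sorted_eq ltn_trans ltnn sP (des_sorted ca)) => x.
by rewrite e.
Qed.

Lemma comp_of_peak alpha T (beta := comp_of (sumn alpha) (peak (desT T))) :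
  is_comp alpha -> T \in SPYCT alpha ->
  [/\ is_peak_comp beta, sumn beta = sumn alpha & des beta = peak (desT T)].
Proof.
move=> ca TS; have TF := SPYCT_fillings ca TS.
have sP := peak_sorted (desT_sorted T); have rP := peak_range (desT_range TF).
have dE : des beta = peak (desT T) by exact: des_comp_of.
split=> //; last exact: sumn_comp_of.
by apply: peak_compP; rewrite ?dE ?peakK_id // is_comp_comp_of.
Qed.

(** * The triangular system and the basis *)

Section Basis.
Variable ch : forall n, supermod F n -> series F.
Hypothesis chP : is_peak_char ch.

Lemma peakYQS_coef alpha n P : is_comp alpha -> uniq P ->
  peakYQS ch alpha (mono n P) =
  (\sum_(T <- SPYCT alpha) kcoef (comp_of (sumn alpha) (peak (desT T))) n P)%:R.
Proof.
move=> ca uP; rewrite (peakYQS_sum ca chP) fct_sumE natr_sum; apply: eq_bigr => T _.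
exact: peakK_coef.
Qed.

(** Some T in SPYCT(beta) contributes, and then wt(Des(beta)) <= wt(Peak(T)) <= wt(Des(alpha)).
    Equality throughout forces the three sets to coincide. *)
Lemma peakYQS_coef_neq0 alpha beta : is_peak_comp alpha -> is_peak_comp beta ->
  peakYQS ch beta (mono (sumn alpha) (des alpha)) != 0 ->
  beta = alpha \/ (wt (sumn beta) (des beta) < wt (sumn alpha) (des alpha))%N.
Proof.
move=> pa pb; have ca : is_comp alpha by case/andP: pa.
have cb : is_comp beta by case/andP: pb.
have ua : uniq (des alpha) by rewrite (sorted_uniq ltn_trans ltnn) ?des_sorted.
have ra : all (ltn^~ (sumn alpha)) (des alpha).
  by apply: sub_all (des_range ca) => i /andP [].
rewrite peakYQS_coef // F0 sum_nat_seq_neq0 => /hasP [T TS /=].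
have [pg sg dg] := comp_of_peak cb TS; have cg := andP pg.
move=> /(kcoef_neq0 cg.1 ua ra); rewrite sg dg peakK_id => -[san le eqw].
have [le' eqw'] := SPYCT_peak_wt pb TS; rewrite -san in le eqw *.
have [e|ne] := eqVneq (wt (sumn beta) (des beta)) (wt (sumn beta) (des alpha)); last first.
  by right; rewrite ltn_neqAle ne (leq_trans le' le).
have e1 : wt (sumn beta) (des beta) = wt (sumn beta) (peak (desT T)) by lia.
have e2 : wt (sumn beta) (peak (desT T)) = wt (sumn beta) (des alpha) by lia.
left; rewrite -(comp_of_des cb) -(comp_of_des ca) -san; congr comp_of.
apply: (irr_sorted_eq ltn_trans ltnn (des_sorted cb) (des_sorted ca)) => x.
by rewrite -(eqw e2) (eqw' e1).
Qed.

Lemma peakYQS_coef_diag alpha : is_peak_comp alpha ->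
  peakYQS ch alpha (mono (sumn alpha) (des alpha)) != 0.
Proof.
move=> pa; have ca : is_comp alpha by case/andP: pa.
rewrite peakYQS_coef //; last by rewrite (sorted_uniq ltn_trans ltnn) ?des_sorted.
rewrite F0 sum_nat_seq_neq0; apply/hasP; exists (row_filling alpha).
  exact: row_filling_SPYCT.
by rewrite des_row_filling // peak_des // comp_of_des //= kcoef_diag.
Qed.

(** Induction on the weight: the coefficient of x^alpha in the relation involves only alpha and
    compositions of smaller weight, whose scalars already vanish. *)
Lemma peakYQS_lin_indep : lin_indep is_peak_comp (peakYQS ch).
Proof.
move=> s a us sP sum0 alpha; have [m] := ubnP (wt (sumn alpha) (des alpha)).
elim: m alpha => // m IH alpha am alphas.
have pa := allP sP _ alphas.
have := congr1 (fun f : series F => f (mono (sumn alpha) (des alpha))) sum0.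
rewrite fct_sumE (bigD1_seq alpha) //= big1_seq ?addr0.
  move/eqP; rewrite mulf_eq0 (negPf (peakYQS_coef_diag pa)) orbF => /eqP //.
move=> beta /andP [ba bs]; have pb := allP sP _ bs.
have [e|/(peakYQS_coef_neq0 pa pb) [e|lt]] :=
    eqVneq (peakYQS ch beta (mono (sumn alpha) (des alpha))) 0.
- by transitivity (a beta * peakYQS ch beta (mono (sumn alpha) (des alpha))); rewrite // e mulr0.
- by rewrite e eqxx in ba.
- transitivity (a beta * peakYQS ch beta (mono (sumn alpha) (des alpha))) => //.
  by rewrite IH ?mul0r //; lia.
Qed.


(** Downward induction on the weight, which [top] bounds. In S_alpha the fillings with peak set
    Des(alpha) give [N] times K_alpha, with [N] positive by the row filling and hence invertible in
    [F]; all others give K_beta of larger weight. *)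
Lemma peakK_span alpha : is_peak_comp alpha ->
  in_span is_peak_comp (peakYQS ch) (peakK F alpha).
Proof.
set top := fun n => wt n (iota 0 n).
have [m] := ubnP (top (sumn alpha) - wt (sumn alpha) (des alpha))%N.
elim: m alpha => // m IH alpha am pa; have ca : is_comp alpha by case/andP: pa.
set n := sumn alpha in am.
have wt_top beta : is_comp beta -> sumn beta = n -> (wt n (des beta) <= top n)%N.
  move=> cb sb; have rb := des_range cb; rewrite sb in rb.
  have [] // := @wt_subset n (iota 0 n) (des beta) (iota_uniq _ _).
  - exact: sorted_uniq ltn_trans ltnn _ (des_sorted cb).
  - by apply/allP => x; rewrite mem_iota.
  - by move=> x /(allP rb) /andP [_ xn]; rewrite mem_iota.
pose N := count (fun T => peak (desT T) == des alpha) (SPYCT alpha).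
have N0 : N%:R != 0 :> F.
  rewrite F0 -lt0n -has_count; apply/hasP; exists (row_filling alpha).
    exact: row_filling_SPYCT.
  by rewrite des_row_filling // peak_des.
have := peakYQS_sum ca chP; rewrite (bigID (fun T => peak (desT T) == des alpha)) /=.
rewrite (eq_bigr (fun=> peakK F alpha)); last by move=> T /eqP ->; rewrite comp_of_des.
rewrite big_const_seq -/N iter_addr_0 => e.
have -> : peakK F alpha = N%:R^-1 *: (peakK F alpha *+ N) + 0.
  by rewrite addr0 -scaler_nat scalerA mulVf // scale1r.
apply: in_span_linear; last exact: in_span0.
set R := \sum_(_ <- _ | _) _ in e.
have -> : peakK F alpha *+ N = (-1) *: R + peakYQS ch alpha.
  by rewrite e scaleN1r [_ + R]addrC addKr.
apply: in_span_linear; last exact: in_span_gen.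
rewrite /R big_seq_cond; apply: in_span_sum => T /andP [TS ne].
have [pb sb db] := comp_of_peak ca TS; apply: IH => //; rewrite sb db -/n.
have [le eqw] := SPYCT_peak_wt pa TS; rewrite -/n in le eqw.
have ltw : (wt n (des alpha) < wt n (peak (desT T)))%N.
  by rewrite ltn_neqAle le andbT; apply/eqP => /eqw /eqP; rewrite (negPf ne).
have := wt_top _ (andP pb).1 sb; rewrite db; lia.
Qed.

Lemma peakYQS_basis : is_basis is_peak_comp (peakYQS ch) (@peak_alg F).
Proof.
split; first by move=> alpha _; have [pa _ _] := chP; exact: pa.
  exact: peakYQS_lin_indep.
move=> _ [s [a [/allP sP ->]]]; rewrite big_seq; apply: in_span_sum => alpha /sP pa.
rewrite -[_ *: _]addr0; apply: in_span_linear; [exact: peakK_span|exact: in_span0].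
Qed.

End Basis.
End Coefficients.

Local Open Scope complex_scope.

Theorem corollary6p11 (R : realType)
    (ch : forall n : nat, supermod R[i] n -> series R[i])
    (chP : is_peak_char ch) :
  is_basis is_peak_comp (peakYQS ch) (@peak_alg R[i]) /\
  forall lambda : seq nat, is_strict_part lambda ->
    exists alpha : seq nat,
      is_peak_comp alpha /\ schurQ R[i] lambda = peakYQS ch alpha.
Proof.
split; first by apply: peakYQS_basis chP => k; exact: Num.Theory.pnatr_eq0.
(* A strict partition is itself a peak composition: only its last part can be 1. *)
move=> lambda sl; exists lambda; have pl := strict_peak_comp sl; split=> //.
by rewrite schurQ_sum // (peakYQS_sum _ chP) //; case/andP: pl.
Qed.
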